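(* Let $\Gamma$ be a non-elementary group acting properly by isometries on a discrete proper roughly geodesic hyperbolic space $(X,d)$ with basepoint $o$. Let $\mu$ be a symmetric non-elementary probability measure on $\Gamma$ with 1st moment, $(X_n)_n$ the $\mu$-random walk starting at the identity, and $\nu$ the unique $\mu$-stationary probability measure on $\partial X$. Let $f_1,f_2:\overline X\to\partial X$ be boundary retractions (possibly equal, possibly different). Then for all continuous functions $\varphi_1,\varphi_2\in C^0(\partial X)$, $$\mathbb{E}\big[\varphi_1(f_1(X_n.o))\,\varphi_2(f_2(X_n^{-1}.o))\big]=\sum_{g\in\Gamma}\varphi_1(f_1(g.o))\,\varphi_2(f_2(g^{-1}.o))\,\mu^{*n}(g)\xrightarrow[n\to+\infty]{}\int_{\partial X}\varphi_1\,d\nu\int_{\partial X}\varphi_2\,d\nu .$$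
   Context: $(X,d)$ is a discrete metric space with finite balls. Hyperbolic means Gromov hyperbolic: with $(x|y)_w=\frac12(d(x,w)+d(y,w)-d(x,y))$, there is $\delta\ge 0$ with $(x|y)_w\ge\min\{(x|z)_w,(z|y)_w\}-\delta$ for all $x,y,z,w\in X$. Roughly geodesic means there is a constant $C$ such that any two points $x,y$ are joined by a map $p:[0,T]\to X$, $p(0)=x$, $p(T)=y$, with $|t-t'|-C\le d(p(t),p(t'))\le|t-t'|+C$ for all $t,t'$. $\overline X=X\cup\partial X$ is the Gromov compactification, $\partial X$ the Gromov boundary. A boundary retraction is a continuous map $f:\overline X\to\partial X$ with $f|_{\partial X}=\mathrm{id}_{\partial X}$. Non-elementary is taken in the usual sense for isometric actions on hyperbolic spaces: the group contains two loxodromic isometries of $X$ with disjoint fixed-point sets in $\partial X$. A probability measure $\mu$ on $\Gamma$ is symmetric if $\mu(g)=\mu(g^{-1})$ for all $g$; a symmetric $\mu$ is non-elementary if the semigroup generated by its support (which is a group) is non-elementary; $\mu$ has a 1st moment if $\sum_{g}d(g.o,o)\mu(g)<\infty$. A probability $\nu$ on $\partial X$ is $\mu$-stationary if $\sum_g\mu(g)\,g_*\nu=\nu$; when $\Gamma$ is a non-elementary group acting properly by isometries on the discrete proper roughly geodesic hyperbolic space $(X,d)$ and $\mu$ is a symmetric non-elementary probability measure on $\Gamma$ with 1st moment, there is exactly one such measure, namely the law of $\lim_n X_n.o\in\partial X$. The $\mu$-random walk starting at the identity is $X_n=H_1\cdots H_n$ with $(H_i)$ i.i.d. of law $\mu$;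 its law at time $n$ is $\mu^{*n}$. *)

(* Defs.v *)
From HB Require Import structures.
From mathcomp Require Import all_boot all_order all_algebra finmap.
From mathcomp Require Import lra.
From mathcomp Require Import all_classical all_reals all_analysis.

Set Implicit Arguments.
Unset Strict Implicit.
Unset Printing Implicit Defensive.

Import Order.TTheory GRing.Theory Num.Theory.
Import numFieldNormedType.Exports.

Local Open Scope classical_set_scope.
Local Open Scope ring_scope.

Section hyperbolic_space.
Context {R : realType} {X : metricType R}.

(* The metric topology of such a space is discrete, and the space is proper. *)
Definition finite_balls :=
  forall (x : X) (r : R), finite_set [set y | mdist x y <= r].

Definition gromov_product (w x y : X) : R :=
  (mdist x w + mdist y w - mdist x y) / 2.

Definition hyperbolic := exists2 delta : R, 0 <= delta &
  forall x y z w : X,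
    Num.min (gromov_product w x z) (gromov_product w z y) - delta
      <= gromov_product w x y.

Definition roughly_geodesic := exists C : R, forall x y : X,
  exists (T : R) (p : R -> X), [/\ 0 <= T, p 0 = x, p T = y &
    forall t t' : R, 0 <= t <= T -> 0 <= t' <= T ->
      `|t - t'| - C <= mdist (p t) (p t') <= `|t - t'| + C].

Lemma gromov_product_isometry (a : X -> X) (w x y : X) :
  (forall u v, mdist (a u) (a v) = mdist u v) ->
  gromov_product (a w) (a x) (a y) = gromov_product w x y.
Proof. by move=> aE; rewrite /gromov_product !aE. Qed.

Lemma gromov_product_basepoint (o w x y : X) :
  gromov_product o x y - mdist o w <= gromov_product w x y.
Proof.
rewrite /gromov_product.
have h1 := metric_triangle x w o; have h2 := metric_triangle y w o.
rewrite (metric_sym w o) in h1 h2; lra.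
Qed.

Section boundary.
Variable o : X.

(* (u_i | v_j)_o --> +oo as i, j --> oo *)
Definition asymptotic (u v : nat -> X) := forall M : R, exists N : nat,
  forall i j : nat, (N <= i)%N -> (N <= j)%N -> M <= gromov_product o (u i) (v j).

Definition converges_to_infinity (u : nat -> X) := asymptotic u u.

Definition asymptotic_class (u : nat -> X) : set (nat -> X) :=
  [set v | converges_to_infinity v /\ asymptotic u v].

(* Asymptoticity is an equivalence relation only when X is hyperbolic, hence
   the classes as sets of sequences rather than a quotient type. *)
Record boundary := Boundary {
  boundary_class : set (nat -> X);
  boundary_classP : exists2 u, converges_to_infinity u &
                               boundary_class = asymptotic_class u }.

HB.instance Definition _ := gen_eqMixin boundary.
HB.instance Definition _ := gen_choiceMixin boundary.

Inductive compactification := Inner of X | Bdry of boundary.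

HB.instance Definition _ := gen_eqMixin compactification.
HB.instance Definition _ := gen_choiceMixin compactification.

Definition represents (a : compactification) (u : nat -> X) : Prop :=
  match a with
  | Inner x => u @ \oo --> x
  | Bdry xi => boundary_class xi u
  end.

(* (a | b)_o = sup liminf_{i,j} (u_i | v_j)_o, the sup being taken over the
   sequences u and v of points of X that represent a and b. *)
Definition ext_gromov_product (a b : compactification) : \bar R :=
  ereal_sup [set ereal_sup (range (fun N : nat =>
      ereal_inf [set (gromov_product o (uv.1 ij.1) (uv.2 ij.2))%:E
                | ij in [set ij : nat * nat | (N <= ij.1)%N /\ (N <= ij.2)%N]]))
    | uv in [set uv : (nat -> X) * (nat -> X) |
             represents a uv.1 /\ represents b uv.2]].

(* X is open in its compactification, and the sets {a | (xi | a)_o > r} are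
   a basis of (not necessarily open) neighborhoods of the boundary point xi. *)
Definition compactification_open : set_system compactification :=
  [set U | open (Inner @^-1` U) /\
    forall xi : boundary, U (Bdry xi) -> exists r : R,
      [set a | (r%:E < ext_gromov_product (Bdry xi) a)%E] `<=` U].

Let compactification_openT : compactification_open setT.
Proof. by split=> [|xi _]; [exact: openT|exists 0]. Qed.

Let compactification_openI : setI_closed compactification_open.
Proof.
move=> U V [oU hU] [oV hV]; split; first exact: openI.
move=> xi [/hU[r rU] /hV[s sV]]; exists (Num.max r s) => a /= ha.
by split; [apply: rU|apply: sV] => /=; apply: le_lt_trans ha;
  rewrite lee_fin le_max lexx ?orbT.
Qed.

Let compactification_open_bigU (I : Type) (f : I -> set compactification) :
  (forall i, compactification_open (f i)) ->
  compactification_open (\bigcup_i f i).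
Proof.
move=> hf; split.
  by rewrite preimage_bigcup; apply: bigcup_open => i _; case: (hf i).
move=> xi [i _ fi]; have [_ /(_ _ fi)[r rf]] := hf i.
by exists r => a /rf; exists i.
Qed.

HB.instance Definition _ := isOpenTopological.Build compactification
  compactification_openT compactification_openI compactification_open_bigU.

HB.instance Definition _ := Topological.copy boundary (initial_topology Bdry).

(* measurableType requires an inhabitant, whence the parameter xi0, on which
   the sigma-algebra does not depend. *)
Definition borel_boundary (xi0 : boundary) : Type := boundary.

Section borel_boundary.
Variable xi0 : boundary.

HB.instance Definition _ := Choice.on (borel_boundary xi0).
HB.instance Definition _ := isPointed.Build (borel_boundary xi0) xi0.
HB.instance Definition _ :=
  @isMeasurable.Build (sigma_display (@open boundary : set (set boundary)))
    (borel_boundary xi0) <<s @open boundary >> (@sigma_algebra0 _ setT _)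
    (@sigma_algebraC _ _) (@sigma_algebra_bigcup _ setT _).

End borel_boundary.

Definition boundary_retraction (f : compactification -> boundary) :=
  continuous f /\ forall xi, f (Bdry xi) = xi.

End boundary.

End hyperbolic_space.

Arguments finite_balls {R} X.
Arguments hyperbolic {R} X.
Arguments roughly_geodesic {R} X.
Arguments Inner {R X o} x.
Arguments Bdry {R X o} xi.

Record isometric_action (R : realType) (G : groupType) (X : metricType R) :=
  IsometricAction {
    action_fun :> G -> X -> X;
    action1 : forall x, action_fun 1%g x = x;
    actionM : forall g h x,
      action_fun (g * h)%g x = action_fun g (action_fun h x);
    action_isometry : forall g x y,
      mdist (action_fun g x) (action_fun g y) = mdist x y }.

Section action.
Context {R : realType} {G : groupType} {X : metricType R}.
Variable act : isometric_action G X.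

Definition proper_action := forall K : set X, compact K ->
  finite_set [set g | act g @` K `&` K !=set0].

Lemma actionK g : cancel (act g) (act g^-1%g).
Proof. by move=> x; rewrite -actionM mulVg action1. Qed.

Lemma actionKV g : cancel (act g^-1%g) (act g).
Proof. by move=> x; rewrite -actionM mulgV action1. Qed.

Section boundary_action.
Variable o : X.

Lemma asymptotic_act g (u v : nat -> X) :
  asymptotic o u v -> asymptotic o (act g \o u) (act g \o v).
Proof.
move=> uv M; have [N hN] := uv (M + mdist (act g o) o).
exists N => i j Ni Nj /=.
have := gromov_product_basepoint (act g o) o (act g (u i)) (act g (v j)).
rewrite gromov_product_isometry; last exact: action_isometry.
by have := hN i j Ni Nj; lra.
Qed.

Lemma asymptotic_class_act g (u : nat -> X) :
  [set v | asymptotic_class o u (act g^-1%g \o v)]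
  = asymptotic_class o (act g \o u).
Proof.
have K (v : nat -> X) : act g \o (act g^-1%g \o v) = v.
  by apply/funext => i /=; rewrite actionKV.
have K' (v : nat -> X) : act g^-1%g \o (act g \o v) = v.
  by apply/funext => i /=; rewrite actionK.
apply/seteqP; split => v [/= v1 v2]; split.
- by have := asymptotic_act g v1; rewrite K.
- by have := asymptotic_act g v2; rewrite K.
- exact: asymptotic_act.
- by have := asymptotic_act g^-1%g v2; rewrite K'.
Qed.

Lemma boundary_act_subproof g (xi : boundary o) :
  exists2 u, converges_to_infinity o u &
    [set v | boundary_class xi (act g^-1%g \o v)] = asymptotic_class o u.
Proof.
have [u u1 xiu] := boundary_classP xi.
exists (act g \o u); first exact: asymptotic_act.
by rewrite -asymptotic_class_act xiu.
Qed.

Definition boundary_act g (xi : boundary o) : boundary o :=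
  Boundary (boundary_act_subproof g xi).

Definition boundary_fixed_points g : set (boundary o) :=
  [set xi | boundary_act g xi = xi].

End boundary_action.

Arguments boundary_fixed_points : clear implicits.

Definition int_power (g : G) (k : int) : G :=
  match k with
  | Posz n => (g ^+ n)%g
  | Negz n => (g ^- n.+1)%g
  end.

(* The orbit maps k |-> g^k x, from the integers to X, are quasi-isometric
   embeddings. *)
Definition loxodromic (g : G) := forall x : X, exists L C : R, 1 <= L /\
  forall k l : int,
    L^-1 * `|k - l|%:~R - C <= mdist (act (int_power g k) x)
                                     (act (int_power g l) x)
                            <= L * `|k - l|%:~R + C.

Definition nonelementary (o : X) (S : set G) := exists g h : G,
  [/\ S g, S h, loxodromic g, loxodromic h &
      boundary_fixed_points o g `&` boundary_fixed_points o h = set0].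

End action.

Section random_walk.
Context {R : realType} {G : groupType}.
Implicit Types mu : G -> R.
Local Open Scope ereal_scope.

(* G is a discrete group: probability measures on G are given by weights. *)
Definition probability_weights mu :=
  (forall g, 0 <= mu g)%R /\ \esum_(g in [set: G]) (mu g)%:E = 1.

Definition symmetric_weights mu := forall g, mu g = mu g^-1%g.

Definition generated_semigroup (A : set G) : set G :=
  smallest [set S | forall g h, S g -> S h -> S (g * h)%g] A.

Definition support_weights mu : set G := [set g | mu g != 0%R].

Definition first_moment (X : metricType R) (act : isometric_action G X) (o : X)
  mu := \esum_(g in [set: G]) (mdist (act g o) o * mu g)%:E < +oo.

Definition convolution mu1 mu2 : G -> R :=
  fun g => fine (\esum_(h in [set: G]) (mu1 h * mu2 (h^-1 * g)%g)%:E).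

Fixpoint convolution_power mu (n : nat) : G -> R :=
  if n is n'.+1 then convolution (convolution_power mu n') mu
  else fun g => ((g == 1%g)%:R)%R.

(* Sum of an absolutely summable family of real numbers of any signs; esum
   itself is meant for nonnegative families. *)
Definition sum_over (F : G -> R) : \bar R :=
  \esum_(g in [set: G]) (EFin \o F)^\+ g
    - \esum_(g in [set: G]) (EFin \o F)^\- g.

Definition iid_of_law mu (d : measure_display) (Omega : measurableType d)
    (P : probability Omega R) (H : nat -> Omega -> G) :=
  [/\ forall i (A : set G), measurable (H i @^-1` A),
      forall i g, P (H i @^-1` [set g]) = (mu g)%:E &
      forall (J : {fset nat}) (A : nat -> set G),
        P (\bigcap_(i in [set` J]) H i @^-1` A i)
        = \prod_(i <- J) P (H i @^-1` A i)].

(* The increments are numbered from 0: X_n = H_0 * ... * H_(n-1). *)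
Definition walk (Omega : Type) (H : nat -> Omega -> G) (n : nat) (w : Omega) :=
  (\big[*%g/1%g]_(i < n) H i w)%g.

Definition stationary (X : metricType R) (act : isometric_action G X) (o : X)
    (xi0 : boundary o) mu (nu : probability (borel_boundary xi0) R) :=
  forall A : set (borel_boundary xi0), measurable A ->
    \esum_(g in [set: G])
      (mu g)%:E * pushforward nu
        (boundary_act act g : borel_boundary xi0 -> borel_boundary xi0) A
    = nu A.

End random_walk.

(* Main.v *)
Require Import Defs.
From HB Require Import structures.
From mathcomp Require Import all_boot all_order all_algebra finmap.
From mathcomp Require Import all_classical all_reals all_analysis.
From mathcomp Require Import lra measurable_realfun.

Set Implicit Arguments.
Unset Strict Implicit.
Unset Printing Implicit Defensive.

Import Order.TTheory GRing.Theory Num.Theory.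
Import numFieldNormedType.Exports.

Local Open Scope classical_set_scope.
Local Open Scope ring_scope.

(** The limit is identified through the stationarity of [nu].  Write [P_n] for
    the [n]-th convolution power of [mu].

    - [nu] has no atoms ([stationary_no_atom]) and the walk leaves every finite
      set ([walk_escapes]).  Both follow from one maximum principle
      ([no_concentration]): the suprema of weights that are averaged by the
      walk tend to zero, since arbitrarily many images of a point of nearly
      maximal weight have at least half of this weight.  That the images are distinct comes, on the boundary,
      from the two loxodromic elements with disjoint fixed points and from the
      fact that a point fixed by a power of one of them is fixed by the element
      itself ([boundary_fixed_root]).

    - By compactness of the boundary ([boundary_cluster]) the absence of atoms
      is uniform: the shadow of a far away point has small [nu]-measure
      ([shadow_mass_small]).  An element [g] with [g o] far away maps everything
      outside the shadow of [g^-1 o] close to [g o] ([near_at_act_orbit]), so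
      that [g] pushes most of the mass of [nu] close to [g o].  Averaging over
      [P_n] and using that [nu] is the average of its images, the law of [g o]
      converges to [nu] ([walk_cvg_stationary]) and the walk avoids every given
      shadow with high probability, uniformly in the shadow
      ([walk_avoids_shadow]).

    - Split [g = a b] with [a] and [b] independent of laws [P_m] and [P_k].  As
      [b o] avoids the shadow of [a^-1 o], the point [g o] is close to [a o]
      ([walk_decoupling]).  By symmetry of [mu] the same applies to
      [g^-1 = b^-1 a^-1], so [g^-1 o] is close to [b^-1 o].  Continuous functions
      on the compactification being uniformly continuous for this notion of
      closeness ([compactification_uniform_continuous]), the mean of the product
      is asymptotically the product of the means ([walk_joint_cvg]).

    The identity for the expectation expresses that the convolution power [P_n]
    is the law of the walk at time [n] ([walk_law], [expectation_walk]). *)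

(** * Gromov products and sequences representing points *)

(** The four-point inequality of Gromov hyperbolicity, with its constant. *)
Definition delta_hyperbolic {R : realType} (X : metricType R) (delta : R) :=
  forall x y z w : X,
    Num.min (gromov_product w x z) (gromov_product w z y) - delta
      <= gromov_product w x y.

Section near.
Context {R : realType} {X : metricType R} (o : X).
Implicit Types (u v w : nat -> X) (x y : X) (r s : R).

(** The inequality [r <= (u_i | v_j)_o] holds for all large [i] and [j].  Taking
    constant sequences, this covers points of [X] and boundary points alike. *)
Definition near_at (r : R) (u v : nat -> X) := exists N : nat, forall i j : nat,
  (N <= i)%N -> (N <= j)%N -> r <= gromov_product o (u i) (v j).

Lemma gromov_product_sym x y : gromov_product o x y = gromov_product o y x.
Proof. by rewrite /gromov_product (metric_sym x y) [mdist x o + _]addrC. Qed.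

Lemma gromov_product_self x : gromov_product o x x = mdist x o.
Proof. rewrite /gromov_product mdistxx; lra. Qed.

Lemma gromov_product_lel x y : gromov_product o x y <= mdist x o.
Proof.
rewrite /gromov_product; have := metric_triangle y x o.
by rewrite (metric_sym y x); lra.
Qed.

Lemma gromov_product_shift x y z :
  gromov_product o x y - mdist y z <= gromov_product o x z.
Proof.
rewrite /gromov_product; have := metric_triangle y z o.
have := metric_triangle x y z; lra.
Qed.

Lemma near_at_sym r u v : near_at r u v -> near_at r v u.
Proof.
by move=> [N h]; exists N => i j Ni Nj; rewrite gromov_product_sym; exact: h.
Qed.

Lemma near_at_le r s u v : s <= r -> near_at r u v -> near_at s u v.
Proof.
by move=> sr [N h]; exists N => i j Ni Nj; apply: le_trans sr _; exact: h.
Qed.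

Lemma near_at_cst r x y : near_at r (cst x) (cst y) <-> r <= gromov_product o x y.
Proof.
by split=> [[N]/(_ N N (leqnn _) (leqnn _))//|h]; exists 0%N.
Qed.

Lemma near_at_shift r u x y :
  near_at r u (cst x) -> near_at (r - mdist x y) u (cst y).
Proof.
move=> [N h]; exists N => i j Ni Nj /=.
by have := gromov_product_shift (u i) x y; have := h i j Ni Nj; rewrite /cst; lra.
Qed.

Lemma asymptoticP u v : asymptotic o u v <-> forall r, near_at r u v.
Proof. by []. Qed.

Context (delta : R) (hyp : delta_hyperbolic X delta).

Lemma near_at_trans r s u v w :
  near_at r u v -> near_at s v w -> near_at (Num.min r s - delta) u w.
Proof.
move=> [N h] [M k]; exists (maxn N M) => i j.
rewrite !geq_max => /andP[Ni Mi] /andP[Nj Mj].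
apply: le_trans (hyp _ _ (v i) _); rewrite lerD2r.
by apply: le_min2; [exact: h|exact: k].
Qed.

Lemma near_at_trans_le t r s u v w : t + delta <= r -> t + delta <= s ->
  near_at r u v -> near_at s v w -> near_at t u w.
Proof.
move=> tr ts uv vw; apply: near_at_le (near_at_trans uv vw).
by rewrite lerBrDr le_min tr ts.
Qed.

Lemma asymptotic_sym u v : asymptotic o u v -> asymptotic o v u.
Proof. by move=> h r; exact: near_at_sym (h r). Qed.

Lemma asymptotic_near_at t r u v w : t + delta <= r ->
  asymptotic o u v -> near_at r v w -> near_at t u w.
Proof. by move=> tr uv; apply: near_at_trans_le (uv _). Qed.

Lemma asymptotic_trans u v w :
  asymptotic o u v -> asymptotic o v w -> asymptotic o u w.
Proof. by move=> uv vw r; exact: (asymptotic_near_at (lexx _) uv (vw _)). Qed.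

(** Sequences representing a point of the compactification; inner points are
    only represented by constant sequences. *)
Definition germ (a : compactification o) (u : nat -> X) : Prop :=
  match a with Inner x => u = cst x | Bdry xi => boundary_class xi u end.

Lemma germ_represents a u : germ a u -> represents a u.
Proof. by case: a => [x ->|//] /=; exact: cvg_cst. Qed.

Lemma boundary_class_asymptotic (xi : boundary o) u v :
  boundary_class xi u -> boundary_class xi v -> asymptotic o u v.
Proof.
have [w ww ->] := boundary_classP xi => -[uu wu] [vv wv].
exact: asymptotic_trans (asymptotic_sym wu) wv.
Qed.

Lemma boundary_class_closed (xi : boundary o) u v :
  boundary_class xi u -> asymptotic o u v -> boundary_class xi v.
Proof.
have [w ww ->] := boundary_classP xi => -[uu wu] uv; split.
  exact: asymptotic_trans (asymptotic_sym uv) uv.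
exact: asymptotic_trans wu uv.
Qed.

Lemma boundary_class_ex (xi : boundary o) : exists u, boundary_class xi u.
Proof. by have [w ww ->] := boundary_classP xi; exists w. Qed.

Lemma boundary_eq (xi eta : boundary o) :
  boundary_class xi = boundary_class eta -> xi = eta.
Proof.
case: xi => A hA; case: eta => B hB /= AB; subst B.
by congr Boundary; exact: Prop_irrelevance.
Qed.

Lemma boundary_asymptotic_eq (xi eta : boundary o) u v :
  boundary_class xi u -> boundary_class eta v -> asymptotic o u v -> xi = eta.
Proof.
move=> xu ev uv; apply: boundary_eq; apply/seteqP; split => w hw.
  apply: boundary_class_closed ev _; apply: asymptotic_trans (asymptotic_sym uv) _.
  exact: boundary_class_asymptotic xu hw.
apply: boundary_class_closed xu _; apply: asymptotic_trans uv _.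
exact: boundary_class_asymptotic ev hw.
Qed.

Lemma boundary_of_seq u : converges_to_infinity o u ->
  exists xi : boundary o, boundary_class xi u.
Proof.
move=> uu; have hu : exists2 v, converges_to_infinity o v &
  asymptotic_class o u = asymptotic_class o v by exists u.
by exists (Boundary hu); split.
Qed.

Lemma near_at_ext_gromov_product r (a b : compactification o) u v :
  represents a u -> represents b v -> near_at r u v ->
  (r%:E <= ext_gromov_product a b)%E.
Proof.
move=> au bv [N h]; apply: le_ereal_sup_tmp; eexists; first by exists (u, v).
apply: le_ereal_sup_tmp; eexists; first by exists N.
by apply: le_ereal_inf_tmp => _ [[i j] /= [Ni Nj] <-]; rewrite lee_fin h.
Qed.

Lemma ext_gromov_product_near_at r (a b : compactification o) :
  (r%:E < ext_gromov_product a b)%E ->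
  exists u v, [/\ represents a u, represents b v & near_at r u v].
Proof.
move=> /ereal_sup_gt[_ [[u v] [/= au bv] <-]] /ereal_sup_gt[_ [N _ <-]] hr.
exists u, v; split=> //; exists N => i j Ni Nj.
rewrite -lee_fin; apply: le_trans (ltW hr) _.
by apply: ereal_inf_lbound; exists (i, j).
Qed.

(** The topology of the boundary, described with any representing sequences: the
    hyperbolicity constant absorbs the choice of these. *)
Lemma boundary_openP (A : set (boundary o)) :
  open A <-> forall xi u, A xi -> boundary_class xi u -> exists r,
    forall eta v, boundary_class eta v -> near_at r u v -> A eta.
Proof.
split.
  move=> [B [_ /= oB] <-] xi u /= Bxi xu; have [r hr] := oB _ Bxi.
  exists (r + 1) => eta v ev uv; apply: hr => /=.
  by apply: lt_le_trans (near_at_ext_gromov_product _ _ uv);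
    rewrite // lte_fin ltrDl.
move=> h; exists ([set a | forall xi, a = Bdry xi -> A xi]).
  split.
    rewrite [X in open X](_ : _ = setT); first exact: openT.
    by apply/seteqP; split.
  move=> xi /(_ _ erefl) Axi; have [u xu] := boundary_class_ex xi.
  have [r hr] := h _ _ Axi xu; exists (r + delta) => a /= + eta aE.
  rewrite aE => /ext_gromov_product_near_at[u' [v [/= xu' ev uv]]].
  apply: (hr _ _ ev); apply: asymptotic_near_at uv => //.
  exact: boundary_class_asymptotic xu'.
by apply/seteqP; split => [xi /= /(_ _ erefl)//|xi Axi _ [<-]].
Qed.

(** Continuity at a boundary point, tested on inner and boundary points alike. *)
Lemma compactification_continuousP (F : compactification o -> R) (xi : boundary o)
    u (e : R) : continuous F -> boundary_class xi u -> 0 < e ->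
  exists r, forall a v, germ a v -> near_at r u v -> `|F (Bdry xi) - F a| < e.
Proof.
move=> /continuousP cF xu e0.
have [_ /(_ xi)[|r hr]] := cF _ (ball_open (F (Bdry xi)) e).
  exact: ballxx.
exists (r + 1) => a v av uv; apply: hr => /=.
apply: lt_le_trans (@near_at_ext_gromov_product _ (Bdry xi) _ _ _ xu (germ_represents av) uv).
by rewrite lte_fin ltrDl.
Qed.

End near.

(** * Isometries near infinity *)

Section isometries.
Context {R : realType} {G : groupType} {X : metricType R}.
Variables (act : isometric_action G X) (o : X).
Context (delta : R) (hyp : delta_hyperbolic X delta).
Implicit Types (g h : G) (u v : nat -> X) (xi eta : boundary o).

Lemma mdist_actV g : mdist (act g^-1%g o) o = mdist (act g o) o.
Proof. by rewrite -(action_isometry act g) actionKV metric_sym. Qed.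

Lemma near_at_act g r u v : near_at o r u v ->
  near_at o (r - mdist (act g o) o) (act g \o u) (act g \o v).
Proof.
move=> [N h]; exists N => i j Ni Nj /=.
have := gromov_product_basepoint (act g o) o (act g (u i)) (act g (v j)).
rewrite gromov_product_isometry; last exact: action_isometry.
by have := h i j Ni Nj; lra.
Qed.

Lemma boundary_class_act g xi u :
  boundary_class xi u -> boundary_class (boundary_act act g xi) (act g \o u).
Proof.
move=> xu /=; rewrite (_ : _ \o _ = u)//.
by apply/funext => i /=; rewrite actionK.
Qed.

Lemma boundary_act1 xi : boundary_act act 1%g xi = xi.
Proof.
apply: boundary_eq => /=; apply/seteqP; split => v /=;
  by rewrite invg1 (_ : _ \o v = v)//; apply/funext => i /=; rewrite action1.
Qed.

Lemma boundary_actM g h xi :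
  boundary_act act (g * h)%g xi = boundary_act act g (boundary_act act h xi).
Proof.
apply: boundary_eq => /=; apply/seteqP; split => v /=;
  rewrite (_ : act (g * h)^-1%g \o v = act h^-1%g \o (act g^-1%g \o v))//;
  by apply/funext => i /=; rewrite invgM actionM.
Qed.

Lemma gromov_product_act g x :
  gromov_product o (act g x) (act g o)
  = mdist (act g o) o - gromov_product o x (act g^-1%g o).
Proof.
rewrite /gromov_product action_isometry mdist_actV.
rewrite -(action_isometry act g x (act g^-1%g o)) actionKV.
lra.
Qed.

(** North-south contraction: whatever does not lie in the direction of
    [g^-1 o] is sent by [g] in the direction of [g o]. *)
Lemma near_at_act_orbit g s u : converges_to_infinity o u ->
  ~ near_at o s u (cst (act g^-1%g o)) ->
  near_at o (mdist (act g o) o - s - delta) (act g \o u) (cst (act g o)).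
Proof.
move=> uu nu; have /asymptoticP/(_ (mdist (act g o) o - s)) guu := asymptotic_act act g uu.
have [N hN] := guu; exists N => i j Ni _.
have [k Nk hk] : exists2 k, (N <= k)%N &
    gromov_product o (u k) (act g^-1%g o) < s.
  apply: contra_notP nu => nk; exists N => k l Nk _.
  by rewrite leNgt; apply/negP => ks; apply: nk; exists k.
apply: le_trans (hyp _ _ (act g (u k)) _).
rewrite lerD2r le_min hN//= gromov_product_act; lra.
Qed.

(** When [g] fixes the boundary point represented by [u], the sequence
    [act g \o u] represents this point too. *)
Lemma near_at_fixed g xi r u x : boundary_act act g xi = xi ->
  boundary_class xi u -> near_at o (r + delta) (act g \o u) (cst x) ->
  near_at o r u (cst x).
Proof.
move=> gxi xu; apply: (asymptotic_near_at hyp) => //.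
apply: (boundary_class_asymptotic hyp xu).
by rewrite -[in X in boundary_class X _]gxi; exact: boundary_class_act.
Qed.

Lemma boundary_act_expn g xi n :
  boundary_act act g xi = xi -> boundary_act act (g ^+ n)%g xi = xi.
Proof.
move=> gxi; elim: n => [|n ih]; first by rewrite expg0 boundary_act1.
by rewrite expgS boundary_actM ih.
Qed.

(** A boundary point fixed by a power of [g] with unbounded orbits is fixed by
    [g].  Were [xi] and [g xi] distinct, the powers of [g ^+ n] would fix both,
    and every point of the orbit of [o] under these powers would lie close to a
    geodesic between them; a far away one would then be close to [xi] or to
    [g xi] at infinity.  As [g] moves it by a bounded amount, it would be close to
    both. *)
Lemma boundary_fixed_root g n xi :
  (forall M : R, exists k, M <= mdist (act ((g ^+ n) ^+ k)%g o) o) ->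
  boundary_act act (g ^+ n)%g xi = xi -> boundary_act act g xi = xi.
Proof.
move=> unbd gxi; have [u xu] := boundary_class_ex xi.
set eta := boundary_act act g xi; have ev := boundary_class_act g xu.
have geta : boundary_act act (g ^+ n)%g eta = eta.
  by rewrite /eta -boundary_actM -expgSr expgS boundary_actM gxi.
apply: contrapT => ne.
have [c nc] : exists c, ~ near_at o c u (act g \o u).
  apply: contra_notP ne => h; apply: (boundary_asymptotic_eq hyp ev xu).
  apply: asymptotic_sym => r; apply: contrapT => nr.
  by apply: h; exists r.
have uu : converges_to_infinity o u.
  exact: (boundary_class_asymptotic hyp xu xu).
set l := mdist (act g o) o; have l0 : 0 <= l by exact: mdist_ge0.
(* far enough to contradict nc in both cases below *)
have [k hk] := unbd (4 * `|c| + 10 * `|delta| + 2 * l).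
set h := ((g ^+ n) ^+ k)%g in hk.
have hxi : boundary_act act h xi = xi by exact: boundary_act_expn.
have heta : boundary_act act h eta = eta by exact: boundary_act_expn.
have gh : act g (act h o) = act h (act g o).
  rewrite -!actionM; congr (act _ o).
  by apply: commuteX; apply: commuteX; exact: commute_refl.
have gh' : act g^-1%g (act h o) = act h (act g^-1%g o).
  rewrite -!actionM; congr (act _ o).
  apply/commute_sym/commuteV/commute_sym.
  by apply: commuteX; apply: commuteX; exact: commute_refl.
have dgh : mdist (act g (act h o)) (act h o) = l by rewrite gh action_isometry.
have dgh' : mdist (act g^-1%g (act h o)) (act h o) = l.
  by rewrite gh' action_isometry mdist_actV.
have [delta_le c_le] : delta <= `|delta| /\ c <= `|c| by split; exact: ler_norm.
have d0 : 0 <= `|delta| by []. have c0 : 0 <= `|c| by [].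
set s := c + delta.
have [/asboolP su|/asboolP nsu] := boolP `[< near_at o s u (cst (act h^-1%g o)) >].
  have nsv : ~ near_at o s (act g \o u) (cst (act h^-1%g o)).
    move=> sv; apply: nc; apply: (near_at_trans_le hyp _ _ su (near_at_sym sv));
      rewrite /s; lra.
  (* now [act h o] is close to [eta], and its image by [g^-1] close to [xi] *)
  have h1 : near_at o (mdist (act h o) o - s - delta - delta) (act g \o u) (cst (act h o)).
    apply: (near_at_fixed heta ev); rewrite subrK.
    by apply: near_at_act_orbit => //; exact: asymptotic_act.
  have := near_at_act g^-1%g h1; rewrite mdist_actV -/l.
  rewrite (_ : _ \o (_ \o u) = u); last by apply/funext => i /=; rewrite actionK.
  rewrite (_ : _ \o cst _ = cst (act g^-1%g (act h o)))//.
  move=> /(near_at_shift (act h o)); rewrite dgh' => h2.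
  by apply: nc; apply: (near_at_trans_le hyp _ _ h2 (near_at_sym h1));
    rewrite /s; lra.
have h1 : near_at o (mdist (act h o) o - s - delta - delta) u (cst (act h o)).
  by apply: (near_at_fixed hxi xu); rewrite subrK; exact: near_at_act_orbit.
have := near_at_act g h1; rewrite -/l.
rewrite (_ : _ \o cst _ = cst (act g (act h o)))//.
move=> /(near_at_shift (act h o)); rewrite dgh => h2.
by apply: nc; apply: (near_at_trans_le hyp _ _ h1 (near_at_sym h2));
  rewrite /s; lra.
Qed.

End isometries.

(** * Compactness *)

Lemma ex_natr_ge {R : realType} (r : R) :
  exists N : nat, forall n, (N <= n)%N -> r <= n%:R.
Proof. by have [N _ h] := nbhs_infty_ger r; exists N => n /h. Qed.

Section compactness.
Context {R : realType} {X : metricType R} (o : X).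
Context (delta : R) (hyp : delta_hyperbolic X delta).
Hypotheses (hfin : finite_balls X) (hgeo : roughly_geodesic X).

(** The point at distance about [r] from [o] on a rough geodesic from [o] to [x]:
    finitely many points thus approximate all the far away ones. *)
Lemma rough_geodesic_point : exists C : R, forall (r : R) (x : X), 0 <= r ->
  r + C <= mdist x o ->
  exists2 z, mdist o z <= r + C & r <= gromov_product o x z.
Proof.
have [C hC] := hgeo; exists (10 * `|C|) => r x r0 rx.
have [T [p [T0 p0 pT hp]]] := hC o x.
have C0 : 0 <= C.
  have := hp 0 0; rewrite subrr normr0 lexx T0 => /(_ isT isT).
  by rewrite mdistxx => /andP[_]; lra.
rewrite (ger0_norm C0) in rx *.
have z0T : 0 <= (0 : R) <= T by rewrite lexx.
have TT : 0 <= T <= T by rewrite T0 lexx.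
have /andP[h1 h2] := hp _ _ z0T TT.
rewrite p0 pT sub0r normrN (ger0_norm T0) in h1 h2.
rewrite metric_sym in rx.
pose t := r + 2 * C.
have t0T : 0 <= t <= T by rewrite /t; apply/andP; split; lra.
have /andP[h3 h4] := hp _ _ z0T t0T; have /andP[h5 h6] := hp _ _ t0T TT.
have t0 : 0 <= t by case/andP: t0T.
rewrite p0 sub0r normrN (ger0_norm t0) in h3 h4.
rewrite pT in h5 h6.
have tT : `|t - T| = T - t by rewrite distrC ger0_norm//; case/andP: t0T; lra.
rewrite tT in h5 h6.
exists (p t); first by rewrite /t in h4 *; lra.
rewrite /gromov_product (metric_sym x o) (metric_sym (p t) o) (metric_sym x).
rewrite /t in h3 h4 h5 h6 *; lra.
Qed.

(** The points [z r], one for each level [r], chosen along an ultrafilter on the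
    indices, form the sequence that represents the limit. *)
Let boundary_cluster_point (x : nat -> X) :
  (forall n : nat, n%:R <= mdist (x n) o) ->
  exists (xi : boundary o) u, boundary_class xi u /\ forall r N,
    exists2 n, (N <= n)%N & near_at o r u (cst (x n)).
Proof.
move=> hx; have [C hC] := rough_geodesic_point.
have [U [UF Uoo]] := ultraFilterLemma (eventually_filter).
have cut (r : nat) : exists z, U [set n | r%:R - 1 <= gromov_product o (x n) z].
  pose B := [set z | mdist o z <= r%:R + C].
  have /choice[z hz] : forall n : nat, exists z, r%:R + C <= n%:R ->
      B z /\ r%:R <= gromov_product o (x n) z.
    move=> n.
    have [rn|] := leP (r%:R + C) n%:R; last by exists o.
    by have [] := hC r%:R (x n) _ (le_trans rn (hx n)) => // z ? ?; exists z.
  have Ur : U [set n : nat | r%:R + C <= n%:R].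
    by apply: Uoo; exact: nbhs_infty_ger.
  have cB : compact B by apply: finite_compact; exact: hfin.
  have Bz : U (z @^-1` B) by apply: filterS Ur => n /hz[].
  have [y [By zy]] := cB (z @ U) _ Bz.
  exists y.
  have zU : U (z @^-1` ball y 1).
    have [//|nU] := in_ultra_setVsetC (z @^-1` ball y 1) UF.
    have nU' : (z @ U) (~` ball y 1) by [].
    by have [t []] := zy _ _ nU' (nbhsx_ballx y 1 ltr01).
  apply: filterS2 Ur zU => n /hz[_ h1] /=.
  rewrite ballEmdist /= metric_sym => h2.
  by have := gromov_product_shift o (x n) (z n) y; lra.
have [z hz] := choice cut.
have zz (r s : nat) : Num.min r%:R s%:R - 1 - delta <= gromov_product o (z r) (z s).
  have [n [/= h1 h2]] := @filter_ex _ U _ _ (filterI (hz r) (hz s)).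
  apply: le_trans (hyp _ _ (x n) _).
  rewrite lerD2r le_min (gromov_product_sym o (z r)).
  rewrite (le_trans _ h1) ?(le_trans _ h2) ?lerD2r// ge_min lexx ?orbT//.
have cz : converges_to_infinity o z.
  move=> M; have [N hN] := ex_natr_ge (M + delta + 1); exists N => i j Ni Nj.
  apply: le_trans (zz i j); rewrite !lerBrDr le_min.
  by rewrite (hN _ Ni) (hN _ Nj).
have [xi xz] := boundary_of_seq cz.
exists xi, z; split=> // r N.
have [k /(_ k (leqnn _)) hk] := ex_natr_ge (r + 2 * `|delta| + 1).
have d0 := ler_norm delta; have d1 := normr_ge0 delta.
have UN : U [set n | (N <= n)%N] by apply: Uoo; exists N.
have [n [/= h1 h2]] := @filter_ex _ U _ _ (filterI UN (hz k)).
exists n => //.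
have zk : near_at o (k%:R - 1 - delta) z (cst (z k)).
  exists k => i j ki _; apply: le_trans (zz i k).
  by rewrite !lerD2r le_min lexx andbT ler_nat.
have kn : near_at o (k%:R - 1) (cst (z k)) (cst (x n)).
  by apply/near_at_cst; rewrite gromov_product_sym.
by apply: (near_at_trans_le hyp _ _ zk kn); lra.
Qed.

(** Sequential compactness: the [w n], each of which represents a boundary point
    or a point, and which escape every ball, cluster at a boundary point. *)
Lemma boundary_cluster (w : nat -> nat -> X) :
  (forall n : nat, near_at o n%:R (w n) (w n)) ->
  exists (xi : boundary o) u, boundary_class xi u /\ forall r N,
    exists2 n, (N <= n)%N & near_at o r u (w n).
Proof.
move=> hw.
have /choice[x hx] : forall n : nat, exists x,
    n%:R <= mdist x o /\ near_at o n%:R (cst x) (w n).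
  move=> n; have [N hN] := hw n; exists (w n N); split.
    by rewrite -gromov_product_self; exact: hN.
  by exists N => i j _ Nj; exact: hN.
have [xi [u [xu hu]]] := boundary_cluster_point (fun n => proj1 (hx n)).
exists xi, u; split=> // r N; have [M hM] := ex_natr_ge (r + delta).
have [n] := hu (r + delta) (maxn N M); rewrite geq_max => /andP[Nn Mn] un.
exists n => //; apply: (near_at_trans_le hyp _ _ un (proj2 (hx n))) => //.
exact: hM.
Qed.

Lemma near_at_self r u v : near_at o (r + delta) u v -> near_at o r u u.
Proof. by move=> h; exact: (near_at_trans_le hyp _ _ h (near_at_sym h)). Qed.

(** Two points that are close as seen from [o], whether inside or on the boundary,
    have close images under a continuous function, uniformly. *)
Lemma compactification_uniform_continuous (F : compactification o -> R) (e : R) :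
  continuous F -> 0 < e -> exists r : R, forall a b u v,
    germ a u -> germ b v -> near_at o r u v -> `|F a - F b| < e.
Proof.
move=> cF e0; apply: contrapT => nh.
have /choice[p hp] : forall n : nat, exists p : (compactification o * (nat -> X)) *
      (compactification o * (nat -> X)),
    [/\ germ p.1.1 p.1.2, germ p.2.1 p.2.2, near_at o (n%:R + delta) p.1.2 p.2.2 &
        e <= `|F p.1.1 - F p.2.1|].
  move=> n; apply: contra_notP nh => nh; exists (n%:R + delta) => a b u v au bv uv.
  by rewrite ltNge; apply/negP => ab; apply: nh; exists ((a, u), (b, v)).
have hself n : near_at o n%:R (p n).1.2 (p n).1.2.
  by have [_ _ /near_at_self] := hp n.
have [xi [u [xu hu]]] := boundary_cluster hself.
have [r hr] := compactification_continuousP cF xu (divr_gt0 e0 (ltr0n _ 2)).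
have [N hN] := ex_natr_ge (r + `|delta|).
have [n Nn un] := hu (r + `|delta|) N; have [av bv ab] := hp n.
have d0 := ler_norm delta; have d1 := normr_ge0 delta.
have h1 := hr _ _ av (near_at_le _ un); have h2 := hr _ _ bv.
have {}h1 : `|F (Bdry xi) - F (p n).1.1| < e / 2 by apply: h1; lra.
have {}h2 : `|F (Bdry xi) - F (p n).2.1| < e / 2.
  apply: h2; apply: (near_at_trans_le hyp _ _ un ab); first lra.
  by have := hN _ Nn; lra.
rewrite leNgt => /negP; apply.
rewrite (_ : F _ - F _ = (F (Bdry xi) - F (p n).2.1) - (F (Bdry xi) - F (p n).1.1)).
  by apply: le_lt_trans (ler_normB _ _) _; rewrite [e]splitr ltrD.
lra.
Qed.

Lemma boundary_continuous_bounded (phi : boundary o -> R) (f : compactification o -> boundary o) :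
  boundary_retraction f -> continuous phi -> exists M : R, forall xi, `|phi xi| <= M.
Proof.
move=> [cf fid] cphi; apply: contrapT => nb.
have /choice[eta heta] : forall n : nat, exists eta, n%:R < `|phi eta|.
  move=> n; apply: contra_notP nb => nb; exists n%:R => xi.
  by rewrite leNgt; apply/negP => h; apply: nb; exists xi.
have /choice[w hw] : forall n, exists w, boundary_class (eta n) w.
  by move=> n; exact: boundary_class_ex.
have ww n : near_at o n%:R (w n) (w n).
  exact: (boundary_class_asymptotic hyp (hw n) (hw n)).
have [xi [u [xu hu]]] := boundary_cluster ww.
have cF : continuous (phi \o f) by move=> a; apply: continuous_comp; [exact: cf|exact: cphi].
have [r hr] := compactification_continuousP cF xu ltr01.
have [N hN] := ex_natr_ge (`|phi xi| + 1).
have [n Nn un] := hu r N.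
have := hr (Bdry (eta n)) _ (hw n) un; rewrite /= !fid => h.
have := hN _ Nn; have := heta n.
have := lerB_dist (phi (eta n)) (phi xi); rewrite distrC; lra.
Qed.

End compactness.

(** * Means with respect to weights on a group *)

Section esum_extra.
Context {R : realType}.
Local Open Scope ereal_scope.

Lemma ge0_esumZl (T : choiceType) (S : set T) (a : T -> \bar R) (c : R) :
  (0 <= c)%R -> (forall i, 0 <= a i) ->
  \esum_(i in S) (c%:E * a i) = c%:E * \esum_(i in S) a i.
Proof.
move=> c0 a0; rewrite /esum -ereal_supZl//; last first.
  by apply/set0P; exists (\sum_(x \in set0) a x), set0; first exact: fsets_set0.
congr ereal_sup; apply/seteqP; split => x /=.
  move=> [A [fA AS] <-]; exists (\sum_(x \in A) a x); first by exists A.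
  by rewrite ge0_mule_fsumr.
by move=> [_ [A [fA AS] <-] <-]; exists A => //; rewrite ge0_mule_fsumr.
Qed.

Lemma esum_swap (T U : choiceType) (a : T -> U -> \bar R) :
  (forall i j, 0 <= a i j) ->
  \esum_(i in [set: T]) \esum_(j in [set: U]) a i j
  = \esum_(j in [set: U]) \esum_(i in [set: T]) a i j.
Proof.
move=> a0; rewrite esum_esum// [RHS]esum_esum//.
rewrite (reindex_esum ([set: U] `*`` fun=> [set: T]) _ (fun k => (k.2, k.1)))//.
split => //.
- by move=> [i j] [j' i'] _ _ /= [-> ->].
- by move=> [i j] _; exists (j, i).
Qed.

End esum_extra.

Section mean.
Context {R : realType} {G : groupType}.
Implicit Types (p q : G -> R) (F H : G -> R) (M : R).

Definition bounded_function (F : G -> R) := exists M : R, forall g, `|F g| <= M.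

(** The mean of [F] with respect to the weights [p]; it is only meaningful for a
    bounded (or absolutely summable) [F]. *)
Definition mean (p F : G -> R) : R := fine (sum_over (fun g => F g * p g)).

Lemma bounded_function_cst (c : R) : bounded_function (cst c).
Proof. by exists `|c|. Qed.

Lemma bounded_function_add F H : bounded_function F -> bounded_function H ->
  bounded_function (F \+ H).
Proof.
move=> [M hM] [N hN]; exists (M + N) => g /=.
by apply: le_trans (ler_normD _ _) _; rewrite lerD.
Qed.

Lemma bounded_function_mul F H : bounded_function F -> bounded_function H ->
  bounded_function (F \* H).
Proof.
move=> [M hM] [N hN]; exists (M * N) => g /=.
by rewrite normrM ler_pM.
Qed.

Lemma bounded_function_affine (c e : R) F : bounded_function F ->
  bounded_function (fun g => c + e * F g).
Proof.
move=> bF; apply: (@bounded_function_add (cst c)); first exact: bounded_function_cst.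
by apply: (@bounded_function_mul (cst e)) => //; exact: bounded_function_cst.
Qed.

Lemma bounded_function_comp F (k : G -> G) : bounded_function F -> bounded_function (F \o k).
Proof. by move=> [M hM]; exists M => g /=. Qed.

Lemma bounded_function_indic (A : set G) : bounded_function (\1_A : G -> R).
Proof. by exists 1 => g; rewrite indicE; case: (_ \in _); rewrite ?normr1 ?normr0. Qed.

Lemma bounded_function_norm F : bounded_function F -> bounded_function (fun g => `|F g|).
Proof. by move=> [M hM]; exists M => g; rewrite normr_id. Qed.

Section one_weight.
Context (p : G -> R) (hp : probability_weights p).

Let p0 g : 0 <= p g. Proof. exact: hp.1. Qed.

Lemma esum_weights_cst (c : R) : 0 <= c ->
  \esum_(g in [set: G]) (c * p g)%:E = c%:E.
Proof.
move=> c0; under eq_esum do rewrite EFinM.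
by rewrite ge0_esumZl// hp.2 mule1.
Qed.

Let esum_bound F M : (forall g, 0 <= F g <= M) ->
  (0 <= \esum_(g in [set: G]) (F g * p g)%:E <= M%:E)%E.
Proof.
move=> hF; have /andP[F0 FM] := hF 1%g.
rewrite -(esum_weights_cst (le_trans F0 FM)) le_esum ?andbT.
  by apply: esum_ge0 => g _; rewrite lee_fin mulr_ge0//; case/andP: (hF g).
by move=> g _; rewrite lee_fin ler_wpM2r//; case/andP: (hF g).
Qed.

Let esum_fin F M : (forall g, 0 <= F g <= M) ->
  \esum_(g in [set: G]) (F g * p g)%:E \is a fin_num.
Proof.
move=> /esum_bound/andP[h1 h2]; rewrite ge0_fin_numE//.
exact: le_lt_trans h2 (ltry _).
Qed.

Let esum_summable F M : (forall g, 0 <= F g <= M) ->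
  summable [set: G] (fun g => (F g * p g)%:E).
Proof.
move=> h; rewrite /summable (eq_esum (b := fun g => (F g * p g)%:E)).
  by have := esum_fin h; rewrite fin_numElt => /andP[].
by move=> g _; rewrite gee0_abs// lee_fin mulr_ge0//; case/andP: (h g).
Qed.

Let sum_overB F H M N : (forall g, 0 <= F g <= M) -> (forall g, 0 <= H g <= N) ->
  sum_over (fun g => (F g - H g) * p g)
  = (\esum_(g in [set: G]) (F g * p g)%:E - \esum_(g in [set: G]) (H g * p g)%:E)%E.
Proof.
move=> hF hH; rewrite -(esumB (esum_summable hF) (esum_summable hH)).
- rewrite /sum_over (_ : EFin \o _ =
    (fun g => (F g * p g)%:E) \- (fun g => (H g * p g)%:E))%E//.
  by apply/funext => g /=; rewrite mulrBl.
- by move=> g _; rewrite lee_fin mulr_ge0//; case/andP: (hF g).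
- by move=> g _; rewrite lee_fin mulr_ge0//; case/andP: (hH g).
Qed.

Let sum_over_shift F M : (forall g, `|F g| <= M) ->
  sum_over (fun g => F g * p g)
  = (\esum_(g in [set: G]) ((F g + M) * p g)%:E - M%:E)%E.
Proof.
move=> hF; have M0 : 0 <= M by apply: le_trans (normr_ge0 _) (hF 1%g).
have hF' g : 0 <= F g + M <= M + M.
  by have := hF g; rewrite ler_norml => /andP[h1 h2]; apply/andP; split; lra.
have hM (g : G) : 0 <= (cst M g : R) <= M by rewrite /= M0 lexx.
rewrite -[X in (_ - X)%E](esum_weights_cst M0) -(sum_overB hF' hM).
by congr sum_over; apply/funext => g; rewrite addrK.
Qed.

Lemma sum_over_mean F : bounded_function F ->
  sum_over (fun g => F g * p g) = (mean p F)%:E.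
Proof.
move=> [M hF]; rewrite /mean fineK// (sum_over_shift hF) fin_numB andbT.
apply: (@esum_fin _ (M + M)) => g.
by have := hF g; rewrite ler_norml => /andP[h1 h2]; apply/andP; split; lra.
Qed.

Lemma ge0_esum_mean F : bounded_function F -> (forall g, 0 <= F g) ->
  \esum_(g in [set: G]) (F g * p g)%:E = (mean p F)%:E.
Proof.
move=> bF F0; rewrite -sum_over_mean//; have [M hM] := bF.
have hF g : 0 <= F g <= M by rewrite F0 (le_trans (ler_norm _) (hM g)).
have hM0 (g : G) : 0 <= (cst 0 g : R) <= 0 by rewrite /= lexx.
transitivity (sum_over (fun g => (F g - 0) * p g)); last first.
  by congr sum_over; apply/funext => g; rewrite subr0.
by rewrite (sum_overB hF hM0) (esum_weights_cst (lexx _)) sube0.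
Qed.

(** Adding a bound of [F] reduces its mean to the sum of a nonnegative family. *)
Lemma mean_shift F M : (forall g, `|F g| <= M) ->
  mean p F = mean p (fun g => F g + M) - M.
Proof.
move=> hF; apply: EFin_inj; rewrite -sum_over_mean; last by exists M.
rewrite (sum_over_shift hF) EFinB -ge0_esum_mean//.
- by apply: bounded_function_add; [exists M|exact: bounded_function_cst].
- by move=> g; have := hF g; rewrite ler_norml => /andP[h1 h2]; lra.
Qed.

Lemma mean_cst (c : R) : mean p (cst c) = c.
Proof.
have h (x : R) : 0 <= x -> mean p (cst x) = x.
  move=> x0; apply: EFin_inj; rewrite -ge0_esum_mean ?esum_weights_cst//.
  exact: bounded_function_cst.
rewrite (@mean_shift _ `|c|)// (_ : (fun=> _) = cst (c + `|c|))// h ?addrK//.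
have := ler_norm (- c); rewrite normrN; lra.
Qed.

Let ge0_meanD F H : bounded_function F -> bounded_function H ->
  (forall g, 0 <= F g) -> (forall g, 0 <= H g) ->
  mean p (F \+ H) = mean p F + mean p H.
Proof.
move=> bF bH F0 H0; apply: EFin_inj; rewrite EFinD -!ge0_esum_mean//.
- rewrite -esumD; last 2 first.
  + by move=> g _; rewrite lee_fin mulr_ge0.
  + by move=> g _; rewrite lee_fin mulr_ge0.
  by apply: eq_esum => g _; rewrite /= mulrDl.
- exact: bounded_function_add.
- by move=> g; rewrite addr_ge0.
Qed.

Lemma meanD F H : bounded_function F -> bounded_function H ->
  mean p (F \+ H) = mean p F + mean p H.
Proof.
move=> bF bH; have [M hM] := bF; have [N hN] := bH.
have pos (K : G -> R) L : (forall g, `|K g| <= L) -> forall g, 0 <= K g + L.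
  by move=> h g; have := h g; rewrite ler_norml => /andP[h1 h2]; lra.
rewrite (@mean_shift _ (M + N)) => [|g]; last first.
  by apply: le_trans (ler_normD _ _) _; rewrite lerD.
rewrite (mean_shift hM) (mean_shift hN).
rewrite (_ : (fun g => _) = (fun g => F g + M) \+ (fun g => H g + N)); last first.
  by apply/funext => g /=; rewrite addrACA.
rewrite ge0_meanD ?pos//; [lra| | |exact: pos|exact: pos].
- by apply: bounded_function_add => //; exact: bounded_function_cst.
- by apply: bounded_function_add => //; exact: bounded_function_cst.
Qed.

Lemma mean_ge0 F : (forall g, 0 <= F g) -> 0 <= mean p F.
Proof.
move=> F0; apply: fine_ge0; rewrite /sum_over.
rewrite [X in (_ - X)%E]esum1 ?sube0; first by apply: esum_ge0.
move=> g _; rewrite funenegE; apply/max_idPr.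
by rewrite leeNl oppe0 /= lee_fin mulr_ge0.
Qed.

Lemma meanN F : bounded_function F -> mean p (fun g => - F g) = - mean p F.
Proof.
move=> bF; have bN : bounded_function (fun g => - F g).
  by case: bF => M hM; exists M => g; rewrite normrN.
apply/eqP; rewrite -subr_eq0 opprK addrC -meanD//.
rewrite (_ : _ \+ _ = cst 0) ?mean_cst//.
by apply/funext => g /=; rewrite subrr.
Qed.

Lemma meanB F H : bounded_function F -> bounded_function H ->
  mean p (fun g => F g - H g) = mean p F - mean p H.
Proof.
move=> bF bH; rewrite -(meanN bH) -meanD//.
by case: bH => M hM; exists M => g; rewrite normrN.
Qed.

Lemma mean_le F H : bounded_function F -> bounded_function H ->
  (forall g, F g <= H g) -> mean p F <= mean p H.
Proof.
move=> bF bH FH; rewrite -subr_ge0 -meanB//.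
by apply: mean_ge0 => g; rewrite subr_ge0.
Qed.

Lemma norm_mean_le F : bounded_function F -> `|mean p F| <= mean p (fun g => `|F g|).
Proof.
move=> bF; have bN := bounded_function_norm bF.
rewrite ler_norml -meanN// !mean_le//.
- by move=> g; exact: ler_norm.
- by case: bN => M hM; exists M => g; rewrite normrN.
- by move=> g; rewrite lerNl -normrN ler_norm.
Qed.

Lemma mean_bound F M : (forall g, `|F g| <= M) -> `|mean p F| <= M.
Proof.
move=> hM; have bF : bounded_function F by exists M.
apply: le_trans (norm_mean_le bF) _; rewrite -[leRHS]mean_cst.
by apply: mean_le => //; [exact: bounded_function_norm|exact: bounded_function_cst].
Qed.

Lemma meanZ (c : R) F : bounded_function F -> mean p (fun g => c * F g) = c * mean p F.
Proof.
move=> bF; wlog c0 : c / 0 <= c => [h|].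
  have [/h//|/ltW c0] := leP 0 c.
  rewrite -[in RHS](opprK c) mulNr -h ?oppr_ge0// -meanN.
    by congr mean; apply/funext => g; rewrite mulNr opprK.
  by apply: (@bounded_function_mul (cst (- c))) => //; exact: bounded_function_cst.
have [M hM] := bF.
have pos g : 0 <= F g + M.
  by have := hM g; rewrite ler_norml => /andP[h1 h2]; lra.
rewrite (@mean_shift _ (c * M)) => [|g]; last by rewrite normrM ger0_norm ?ler_wpM2l.
rewrite [in RHS](mean_shift hM) mulrBr; congr (_ - _).
rewrite (_ : (fun g => _) = (fun g => c * (F g + M))); last first.
  by apply/funext => g; rewrite mulrDr.
have bFM : bounded_function (fun g => F g + M).
  by apply: bounded_function_add => //; exact: bounded_function_cst.
apply: EFin_inj; rewrite EFinM -!ge0_esum_mean//.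
- rewrite -ge0_esumZl//; last by move=> g; rewrite lee_fin mulr_ge0.
  by apply: eq_esum => g _; rewrite -EFinM mulrA.
- by apply: (@bounded_function_mul (cst c)) => //; exact: bounded_function_cst.
- by move=> g; rewrite mulr_ge0.
Qed.

Lemma mean_affine (c e : R) F : bounded_function F ->
  mean p (fun g => c + e * F g) = c + e * mean p F.
Proof.
move=> bF; rewrite (@meanD (cst c) (fun g => e * F g)) ?mean_cst ?meanZ//.
  exact: bounded_function_cst.
by apply: (@bounded_function_mul (cst e)) => //; exact: bounded_function_cst.
Qed.

Lemma mean_sum (n : nat) (F : nat -> G -> R) : (forall i, bounded_function (F i)) ->
  bounded_function (fun g => \sum_(i < n) F i g) /\
  mean p (fun g => \sum_(i < n) F i g) = \sum_(i < n) mean p (F i).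
Proof.
move=> bF; elim: n => [|n [ih1 ih2]].
  rewrite big_ord0 (_ : (fun g => _) = cst 0) ?mean_cst//.
    by split=> //; exact: bounded_function_cst.
  by apply/funext => g; rewrite big_ord0.
rewrite (_ : (fun g => _) = (fun g => \sum_(i < n) F i g) \+ F n); last first.
  by apply/funext => g; rewrite big_ord_recr.
rewrite big_ord_recr/= -ih2 -meanD//; split=> //; exact: bounded_function_add.
Qed.

Lemma mean_indic1 g : mean p \1_[set g] = p g.
Proof.
apply: EFin_inj; rewrite -ge0_esum_mean//; last exact: bounded_function_indic.
rewrite (esumID [set g])//; last first.
  by move=> i _; rewrite lee_fin mulr_ge0.
rewrite setTI esum_set1 ?lee_fin ?mulr_ge0// indicE mem_set// mul1r.
rewrite esum1 ?adde0// => i [_ /= ig]; rewrite indicE memNset ?mul0r//.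
Qed.

Lemma weights_sum_le1 (s : seq G) : uniq s -> \sum_(g <- s) p g <= 1.
Proof.
move=> us; rewrite -lee_fin -hp.2 -sumEFin.
apply: esum_ge; exists [set` s]; first by split=> //; exact: finite_seq.
by rewrite fsbig_seq.
Qed.

Lemma weight_le1 g : p g <= 1.
Proof. by have := @weights_sum_le1 [:: g] isT; rewrite big_seq1. Qed.

End one_weight.

End mean.

(** * Convolution powers *)

Lemma indic_iff {R : realType} (T U : Type) (A : set T) (B : set U) x y :
  (A x <-> B y) -> \1_A x = \1_B y :> R.
Proof.
move=> AB; rewrite !indicE; congr (nat_of_bool _)%:R.
by apply/idP/idP; rewrite !inE => /AB.
Qed.

Section mean_swap.
Context {R : realType} {G : groupType}.
Implicit Types (p q mu : G -> R) (F H : G -> R) (M : R).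

Lemma bounded_function_mean q (K : G -> G -> R) M : probability_weights q ->
  (forall a b, `|K a b| <= M) -> bounded_function (fun a => mean q (K a)).
Proof. by move=> hq hK; exists M => a; exact: mean_bound. Qed.

Let ge0_mean2 p q (K : G -> G -> R) M :
  probability_weights p -> probability_weights q ->
  (forall a b, 0 <= K a b <= M) ->
  \esum_(a in [set: G]) \esum_(b in [set: G]) (K a b * (p a * q b))%:E
  = (mean p (fun a => mean q (K a)))%:E.
Proof.
move=> hp hq hK.
have nK a b : `|K a b| <= M by case/andP: (hK a b) => h0 h; rewrite ger0_norm.
have K0 a b : 0 <= K a b by case/andP: (hK a b).
rewrite -(ge0_esum_mean hp); last 2 first.
- exact: bounded_function_mean nK.
- by move=> a; exact: mean_ge0.
apply: eq_esum => a _; rewrite mulrC EFinM -(ge0_esum_mean hq)//; last by exists M.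
rewrite -ge0_esumZl//; first by apply: eq_esum => b _; rewrite -EFinM mulrCA.
- exact: hp.1.
- by move=> b; rewrite lee_fin mulr_ge0//; exact: hq.1.
Qed.

Let mean2_shift p q (K : G -> G -> R) M :
  probability_weights p -> probability_weights q ->
  (forall a b, `|K a b| <= M) ->
  mean p (fun a => mean q (K a)) = mean p (fun a => mean q (fun b => K a b + M)) - M.
Proof.
move=> hp hq hK; rewrite -[X in _ - X](mean_cst hp) -meanB//.
- congr mean; apply/funext => a; exact: mean_shift.
- apply: (@bounded_function_mean _ _ (M + M)) => // a b.
  have := hK a b; have := ler_normD (K a b) M.
  have : 0 <= M by apply: le_trans (normr_ge0 _) (hK a b).
  by move=> /ger0_norm ->; lra.
- exact: bounded_function_cst.
Qed.

Let shift_ge0 (x M : R) : `|x| <= M -> 0 <= x + M <= M + M.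
Proof. by rewrite ler_norml => /andP[h1 h2]; apply/andP; split; lra. Qed.

Lemma mean_swap p q (K : G -> G -> R) M :
  probability_weights p -> probability_weights q ->
  (forall a b, `|K a b| <= M) ->
  mean p (fun a => mean q (K a)) = mean q (fun b => mean p (fun a => K a b)).
Proof.
move=> hp hq hK; rewrite (mean2_shift hp hq hK).
rewrite (mean2_shift (K := fun b a => K a b) hq hp (fun a b => hK b a)).
congr (_ - _); apply: EFin_inj.
rewrite -!(ge0_mean2 (M := M + M))//; [|by move=> a b; exact: shift_ge0..].
rewrite esum_swap; last first.
  move=> a b; rewrite lee_fin mulr_ge0 ?mulr_ge0 ?hp.1 ?hq.1//.
  by case/andP: (shift_ge0 (hK a b)).
by apply: eq_esum => b _; apply: eq_esum => a _; rewrite (mulrC (p a)).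
Qed.

Lemma convolutionE p q g : probability_weights p -> probability_weights q ->
  convolution p q g = mean p (fun h => q (h^-1 * g)%g).
Proof.
move=> hp hq; rewrite /convolution (_ : esum _ _ =
  \esum_(h in [set: G]) (q (h^-1 * g)%g * p h)%:E); last first.
  by apply: eq_esum => h _; rewrite mulrC.
rewrite ge0_esum_mean//; last by move=> h; exact: hq.1.
by exists 1 => h; rewrite ger0_norm ?hq.1// weight_le1.
Qed.

Lemma esum_translate (h : G) (f : G -> \bar R) :
  \esum_(g in [set: G]) f g = \esum_(g in [set: G]) f (h * g)%g.
Proof.
apply: reindex_esum; split=> //.
- by move=> a b _ _; exact: mulgI.
- by move=> a _; exists (h^-1 * a)%g => //; rewrite mulVKg.
Qed.

Let esum_convolution p q F : probability_weights p -> probability_weights q ->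
  (forall g, 0 <= F g) ->
  \esum_(g in [set: G]) (F g * convolution p q g)%:E
  = \esum_(a in [set: G]) \esum_(b in [set: G]) (F (a * b)%g * (p a * q b))%:E.
Proof.
move=> hp hq F0.
transitivity (\esum_(g in [set: G]) \esum_(h in [set: G])
    (F g * (p h * q (h^-1 * g)%g))%:E).
  apply: eq_esum => g _; rewrite convolutionE// EFinM -(ge0_esum_mean hp)//.
  - rewrite -ge0_esumZl//.
      by apply: eq_esum => h _; rewrite -EFinM (mulrC (p h)).
    by move=> h; rewrite lee_fin mulr_ge0// ?hp.1 ?hq.1.
  - by exists 1 => h; rewrite ger0_norm ?hq.1// weight_le1.
  - by move=> h; exact: hq.1.
rewrite esum_swap; last first.
  by move=> g h; rewrite lee_fin mulr_ge0// mulr_ge0// ?hp.1 ?hq.1.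
apply: eq_esum => h _; rewrite [LHS](esum_translate h).
by apply: eq_esum => g _; rewrite mulKg.
Qed.

Lemma convolution_weights p q : probability_weights p -> probability_weights q ->
  probability_weights (convolution p q).
Proof.
move=> hp hq; split=> [g|].
  by rewrite convolutionE//; apply: mean_ge0 => // h; exact: hq.1.
have := @esum_convolution _ _ (cst 1) hp hq (fun=> ler01).
under eq_esum do rewrite mul1r; move=> ->.
rewrite (ge0_mean2 (K := fun _ _ => 1) (M := 1))// => [|_ _]; last first.
  by rewrite ler01 lexx.
by rewrite (_ : (fun=> _) = cst 1) ?mean_cst//; apply/funext => a; rewrite mean_cst.
Qed.

(** The convolution [p * q] is the law of the product of independent elements of
    laws [p] and [q]. *)
Lemma mean_convolution p q F : probability_weights p -> probability_weights q ->
  bounded_function F ->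
  mean (convolution p q) F = mean p (fun a => mean q (fun b => F (a * b)%g)).
Proof.
move=> hp hq [M hM]; have hpq := convolution_weights hp hq.
rewrite (mean_shift hpq hM).
rewrite (mean2_shift (K := fun a b => F (a * b)%g) (M := M) hp hq)//.
congr (_ - _); apply: EFin_inj.
have hF g : 0 <= F g + M <= M + M by exact: shift_ge0.
have F0 g : 0 <= F g + M by case/andP: (hF g).
rewrite -ge0_esum_mean//; last first.
  by apply: bounded_function_add; [exists M|exact: bounded_function_cst].
by rewrite esum_convolution// (ge0_mean2 (M := M + M) (K := fun a b => F (a * b)%g + M)).
Qed.

Section powers.
Context (mu : G -> R) (hmu : probability_weights mu).

Lemma convolution_power_weights n : probability_weights (convolution_power mu n).
Proof.
elim: n => [|n ih] /=; last exact: convolution_weights.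
split=> [g|]; first by case: (_ == _).
rewrite (esumID [set 1%g])//.
rewrite setTI esum_set1 ?eqxx// esum1 ?adde0// => g [_ /= /eqP].
by move=> /negbTE ->.
Qed.

Notation mun := (convolution_power mu).

Lemma mean_power0 F : bounded_function F -> mean (mun 0) F = F 1%g.
Proof.
move=> bF; have h0 := convolution_power_weights 0.
have [M hM] := bF; rewrite (mean_shift h0 hM); apply/eqP; rewrite subr_eq; apply/eqP.
have F0 g : 0 <= F g + M by have := hM g; rewrite ler_norml => /andP[]; lra.
apply: EFin_inj; rewrite -ge0_esum_mean//; last first.
  by apply: bounded_function_add => //; exact: bounded_function_cst.
rewrite (esumID [set 1%g])//; last first.
  by move=> g _; rewrite lee_fin mulr_ge0//; exact: h0.1.
rewrite setTI esum_set1 /= ?eqxx ?mulr1 ?lee_fin// esum1 ?adde0// => g [_ /= /eqP].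
by move=> /negbTE ->; rewrite mulr0.
Qed.

Lemma mean_powerD m n F : bounded_function F ->
  mean (mun (m + n)) F = mean (mun m) (fun a => mean (mun n) (fun b => F (a * b)%g)).
Proof.
move=> bF; elim: n F bF => [|n ih] F bF.
  rewrite addn0; congr mean; apply/funext => a.
  rewrite mean_power0 ?mulg1//; exact: (bounded_function_comp (fun b => a * b)%g bF).
have hw := convolution_power_weights.
rewrite addnS /= mean_convolution//; have [M hM] := bF.
rewrite ih; last by apply: (bounded_function_mean (M := M)).
congr mean; apply/funext => a.
rewrite mean_convolution//; last exact: (bounded_function_comp (fun b => a * b)%g bF).
by congr mean; apply/funext => b; congr mean; apply/funext => c; rewrite mulgA.
Qed.

Lemma mean_power1 F : bounded_function F -> mean (mun 1) F = mean mu F.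
Proof.
move=> bF /=; rewrite mean_convolution//; last exact: (convolution_power_weights 0).
rewrite (@mean_power0 (fun a => _)).
  by congr mean; apply/funext => b; rewrite mul1g.
by have [M hM] := bF; apply: (bounded_function_mean (M := M)).
Qed.

(** By symmetry of [mu], the walk and its inverse have the same law at time [n];
    the order of the increments is reversed with [mean_swap]. *)
Lemma mean_powerV n F : symmetric_weights mu -> bounded_function F ->
  mean (mun n) (fun g => F g^-1%g) = mean (mun n) F.
Proof.
move=> sym; have hw := convolution_power_weights.
have muV H : bounded_function H -> mean mu (fun g => H g^-1%g) = mean mu H.
  move=> bH; have [M hM] := bH; rewrite (mean_shift hmu hM).
  rewrite (@mean_shift _ _ _ hmu (fun g => H g^-1%g) M)//; congr (_ - _).
  have H0 g : 0 <= H g + M by have := hM g; rewrite ler_norml => /andP[]; lra.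
  apply: EFin_inj; rewrite -!ge0_esum_mean//; last 2 first.
    by apply: bounded_function_add => //; exact: bounded_function_cst.
    by apply: (@bounded_function_add _ _ (fun g => H g^-1%g)); [exists M|exact: bounded_function_cst].
  rewrite (@reindex_esum _ _ _ [set: G] [set: G] (fun g : G => g^-1%g))//.
    by apply: eq_esum => g _; rewrite invgK -sym.
  split=> //; first by move=> a b _ _; exact: invg_inj.
  by move=> a _; exists a^-1%g => //; rewrite invgK.
elim: n F => [|n ih] F bF.
  by rewrite !mean_power0 ?invg1//; exact: bounded_function_comp bF.
have [M hM] := bF.
rewrite [in LHS]/= mean_convolution//; last exact: bounded_function_comp bF.
under eq_fun do under eq_fun do rewrite invgM.
transitivity (mean (mun n) (fun a => mean mu (fun s => F (s * a^-1)%g))).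
  congr mean; apply/funext => a.
  by rewrite (muV (fun s => F (s * a^-1)%g))//; exact: (bounded_function_comp (fun s => s * a^-1)%g bF).
rewrite (ih (fun a => mean mu (fun s => F (s * a)%g))); last first.
  exact: (bounded_function_mean (M := M)).
rewrite -[n.+1]add1n mean_powerD// mean_power1; last exact: (bounded_function_mean (M := M)).
exact: (mean_swap (M := M)).
Qed.

Lemma convolution_powerV n g : symmetric_weights mu ->
  convolution_power mu n g^-1%g = convolution_power mu n g.
Proof.
move=> sym; have hw := convolution_power_weights n.
rewrite -!(mean_indic1 hw) -[RHS]mean_powerV//; last exact: bounded_function_indic.
congr mean; apply/funext => x; apply: indic_iff.
by split=> /= [->|<-]; rewrite invgK.
Qed.

Lemma convolution_powerD m n g :
  mun (m + n) g = mean (mun m) (fun a => mun n (a^-1 * g)%g).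
Proof.
have hw := convolution_power_weights.
rewrite -(mean_indic1 (hw _)) mean_powerD//; last exact: bounded_function_indic.
congr mean; apply/funext => a; rewrite -(mean_indic1 (hw _)).
congr mean; apply/funext => b; apply: indic_iff.
by split=> /= [<-|->]; rewrite ?mulKg ?mulVKg.
Qed.

Lemma convolution_powerM_gt0 m n a b : 0 < mun m a -> 0 < mun n b ->
  0 < mun (m + n) (a * b)%g.
Proof.
move=> ma nb; have hw := convolution_power_weights.
rewrite convolution_powerD; apply: lt_le_trans (mulr_gt0 ma nb) _.
have -> : mun m a * mun n b = mean (mun m) (fun x => mun n b * \1_[set a] x).
  rewrite (meanZ (hw m)); last exact: bounded_function_indic.
  by rewrite (mean_indic1 (hw m)) mulrC.
apply: mean_le => //.
- by apply: (@bounded_function_mul _ _ (cst (mun n b))); [exact: bounded_function_cst|exact: bounded_function_indic].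
- by exists 1 => x; rewrite ger0_norm ?weight_le1// (hw n).1.
move=> x; rewrite indicE; have [xa|_] := boolP (x \in [set a]); last first.
  by rewrite mulr0 (hw n).1.
by move: xa; rewrite inE => ->; rewrite mulr1 mulKg.
Qed.

Lemma convolution_powerX_gt0 m n a : 0 < mun m a -> 0 < mun (m * n) (a ^+ n)%g.
Proof.
move=> ma; elim: n => [|n ih]; first by rewrite muln0 expg0 /= eqxx.
by rewrite mulnS expgS; exact: convolution_powerM_gt0.
Qed.

Lemma convolution_power1 g : mun 1 g = mu g.
Proof.
rewrite -(mean_indic1 (convolution_power_weights 1)) mean_power1 ?mean_indic1//.
exact: bounded_function_indic.
Qed.

(** The semigroup generated by the support of [mu] is contained in the union of
    the supports of the convolution powers. *)
Lemma generated_semigroup_power g : generated_semigroup (support_weights mu) g ->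
  exists m, 0 < convolution_power mu m.+1 g.
Proof.
suff sub : generated_semigroup (support_weights mu) `<=`
  [set g | exists m, 0 < convolution_power mu m.+1 g] by exact: sub.
apply: smallest_sub => [a b [m ma] [n nb]|a a0].
  by exists (m + n.+1)%N; rewrite -addSn; exact: convolution_powerM_gt0.
by exists 0%N; rewrite convolution_power1 lt_neqAle eq_sym a0 hmu.1.
Qed.

End powers.
End mean_swap.

(** * Mass cannot concentrate *)

Lemma seq_pos_lbound {R : realType} {T : eqType} (f : T -> R) (s : seq T) :
  (forall a, a \in s -> 0 < f a) ->
  exists c : R, [/\ 0 < c, c <= 1 & forall a, a \in s -> c <= f a].
Proof.
elim: s => [|b s ih] hs; first by exists 1.
have [|c [c0 c1 hc]] := ih; first by move=> a as_; apply: hs; rewrite inE as_ orbT.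
exists (Num.min c (f b)); split.
- by rewrite lt_min c0 hs ?mem_head.
- by rewrite ge_min c1.
move=> a; rewrite inE => /orP[/eqP->|/hc]; first by rewrite ge_min lexx orbT.
by move=> h; rewrite ge_min h.
Qed.

Section concentration.
Context {R : realType} {G : groupType} (mu : G -> R).
Hypothesis hmu : probability_weights mu.

(** A maximum principle: let weights [q n], of total mass at most one on [T], be
    such that [q (m + n) x] is the mean over [a], for the law of the walk at time
    [m], of the weights [q n] of the images [op a x].  If the points of [T] have
    arbitrarily many such images, then [q n] tends to zero uniformly.
    Otherwise let [L] be the limit superior of the suprema of the [q n]: the
    images of a point whose weight is almost [L] have weight at least [L / 2], and
    there are too many of them. *)
Lemma no_concentration (T : eqType) (op : G -> T -> T) (q : nat -> T -> R) :
  (forall n x, 0 <= q n x) ->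
  (forall n (s : seq T), uniq s -> \sum_(x <- s) q n x <= 1) ->
  (forall m n x, q (m + n)%N x
    = mean (convolution_power mu m) (fun a => q n (op a x))) ->
  (forall K : nat, exists m (s : seq G),
    (forall a, a \in s -> 0 < convolution_power mu m a) /\
    forall x, (K <= size (undup [seq op a x | a <- s]))%N) ->
  forall e : R, 0 < e -> exists N, forall n x, (N <= n)%N -> q n x <= e.
Proof.
move=> q0 qsum qD hK e e0; apply: contrapT => ne.
have hw := convolution_power_weights hmu.
pose E := [set c | exists N, forall n x, (N <= n)%N -> q n x <= c].
have lbE : lbound E e.
  move=> c [N hN]; rewrite leNgt; apply/negP => ce; apply: ne.
  by exists N => n x Nn; exact: le_trans (hN _ _ Nn) (ltW ce).
have q1 n x : q n x <= 1 by have := qsum n [:: x] isT; rewrite big_seq1.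
have E1 : E 1 by exists 0%N.
have infE : has_inf E by split; [exists 1|exists e].
set L := inf E.
have L0 : 0 < L by apply: lt_le_trans e0 _; apply: lb_le_inf lbE; exists 1.
have [K LK] : exists K : nat, 3 <= K%:R * L.
  have [K _ /(_ K (leqnn _)) /= hK'] := nbhs_infty_ger (3 / L); exists K.
  by rewrite -ler_pdivrMr.
have [m [s [spos ssize]]] := hK K.
have [c [c0 c1 hc]] := seq_pos_lbound spos.
(* the error allowed on L is multiplied by at most 2 / c when passing from the
   mean to one of its terms *)
pose d := c * L / 4.
have d0 : 0 < d by rewrite divr_gt0// mulr_gt0.
have dL : d <= L / 4 by rewrite /d ler_pM2r// ler_piMl// ltW.
have [c' [N hN] c'L] := inf_adherent d0 infE; rewrite -/L in c'L.
have {c' c'L}hN n x : (N <= n)%N -> q n x <= L + d.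
  by move=> /(hN _ x) h; exact: le_trans h (ltW c'L).
have [n [x [Nn hnx]]] : exists n x, (N <= n)%N /\ L - d <= q (m + n)%N x.
  apply: contrapT => nn.
  have : E (L - d).
    exists (m + N)%N => n x mNn; rewrite leNgt; apply/negP => h; apply: nn.
    exists (n - m)%N, x; rewrite subnKC; last exact: leq_trans (leq_addr _ _) mNn.
    by rewrite leq_subRL ?mNn ?ltW//; exact: leq_trans (leq_addr _ _) mNn.
  by move=> /(ge_inf infE.2); rewrite -/L; lra.
have hop a : a \in s -> L / 2 <= q n (op a x).
  move=> as_; set y := op a x.
  have : q (m + n)%N x <= (L + d) - (L + d - q n y) * convolution_power mu m a.
    rewrite qD -[X in _ <= X - _](mean_cst (hw m)) -[X in _ * X](mean_indic1 (hw m)).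
    rewrite -(meanZ (hw m)); last exact: bounded_function_indic.
    rewrite -(meanB (hw m)); last 2 first.
    - exact: bounded_function_cst.
    - apply: (@bounded_function_mul _ _ (cst (L + d - q n y))).
        exact: bounded_function_cst.
      exact: bounded_function_indic.
    apply: (mean_le (hw m)).
    - by exists 1 => z; rewrite ger0_norm.
    - apply: (@bounded_function_add _ _ (cst (L + d)) (fun z => - _)).
        exact: bounded_function_cst.
      exists `|L + d - q n y| => z; rewrite normrN normrM indicE.
      by case: (_ \in _); rewrite ?normr1 ?normr0 ?mulr1 ?mulr0.
    move=> z /=; rewrite indicE; have [|_] := boolP (z \in _).
      by rewrite inE => ->; rewrite mulr1 opprB addrCA subrr addr0.
    by rewrite mulr0 subr0 hN.
  move=> h; have {}h : (L + d - q n y) * c <= 2 * d.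
    apply: le_trans (_ : (L + d - q n y) * convolution_power mu m a <= _).
      by rewrite ler_wpM2l ?hc// subr_ge0 hN.
    lra.
  have : (L + d - q n y) * c <= L / 2 * c by apply: le_trans h _; rewrite /d; lra.
  by rewrite ler_pM2r//; lra.
have := qsum n _ (undup_uniq [seq op a x | a <- s]).
apply/negP; rewrite -ltNge.
have h1 : K%:R * (L / 2) <= \sum_(y <- undup [seq op a x | a <- s]) (L / 2).
  rewrite big_const_seq count_predT iter_addr addr0 -[leRHS]mulr_natl.
  by rewrite ler_wpM2r ?ler_nat ?ssize// divr_ge0// ltW.
apply: (@lt_le_trans _ _ (K%:R * (L / 2))); first by lra.
apply: le_trans h1 _.
rewrite big_seq [leRHS]big_seq; apply: ler_sum => y.
by rewrite mem_undup => /mapP[a as_ ->]; exact: hop.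
Qed.

End concentration.

(** * Loxodromic elements *)

Section spreading.
Context {G : groupType}.

(** The element [g ^ (2 i - K)], written for [i <= K] as a product of [K] factors
    [g] or [g^-1], so that for symmetric weights all these elements are in the
    support of the same convolution power. *)
Definition balanced_power (g : G) (K i : nat) : G := (g ^+ i * g ^- (K - i))%g.

Lemma balanced_power_shift (g : G) (K i j : nat) : (i <= j <= K)%N ->
  (balanced_power g K i)^-1%g
  = ((balanced_power g K j)^-1 * g ^+ (2 * (j - i)))%g.
Proof.
move=> /andP[/subnKC<- /subnKC<-]; move: (j - i)%N => k; move: (K - _)%N => l.
rewrite /balanced_power -[in X in (X - i)%N]addnA !addKn; apply: (@mulIg _ (g ^+ i)%g).
rewrite !invgM !invgK mulgVK -!mulgA -expgnDr mul2n -addnn -addnA (addnC k i).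
by rewrite (addnC k (i + k)%N) [in RHS](expgnDr g (i + k)) mulKg -expgnDr addnC.
Qed.


Lemma balanced_orbit_uniq (T : eqType) (op : G -> T -> T) (g : G) (x : T) (K : nat) :
  op 1%g x = x -> (forall a b, op (a * b)%g x = op a (op b x)) ->
  (forall a y z, op a y = op a z -> y = z) ->
  (forall n, (0 < n)%N -> op (g ^+ n)%g x <> x) ->
  uniq [seq op (balanced_power g K i)^-1%g x | i <- iota 0 K.+1].
Proof.
move=> op1 opM opI free; rewrite map_inj_in_uniq ?iota_uniq//.
move=> i j; rewrite !mem_iota /= !add0n !ltnS.
wlog ij : i j / (i <= j)%N => [h iK jK|iK jK].
  by have [/h|/ltnW/h h'] := leqP i j; [exact|move/esym/h' => ->].
rewrite (@balanced_power_shift _ _ i j) ?ij// opM => /opI.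
have [->//|ne] := eqVneq i j.
by move=> h; case: (free (2 * (j - i))%N _ h); rewrite muln_gt0 /= subn_gt0 ltn_neqAle ne.
Qed.

End spreading.

Section loxodromic.
Context {R : realType} {G : groupType} {X : metricType R}.
Variables (act : isometric_action G X) (o : X).

Lemma loxodromic_unbounded (g : G) n (M : R) : loxodromic act g -> (0 < n)%N ->
  exists k, M <= mdist (act ((g ^+ n) ^+ k)%g o) o.
Proof.
move=> /(_ o)[L [C [L1 h]]] n0; have [k _ /(_ k (leqnn _))/= hk] := nbhs_infty_ger (L * (M + C)).
exists k; have := h (Posz (n * k)%N) (Posz 0); rewrite /int_power expg0 action1 => /andP[h1 _].
rewrite -expgnA; apply: le_trans h1; rewrite subr0 -lerBlDr opprK.
have L0 : 0 < L by lra.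
rewrite ler_pdivlMl//; apply: le_trans hk _.
by rewrite ger0_norm// -[in X in _ <= X]pmulrn ler_nat leq_pmull.
Qed.

Lemma loxodromic_torsion_free (g : G) n : loxodromic act g -> (0 < n)%N ->
  (g ^+ n)%g <> 1%g.
Proof.
move=> gl n0 gn; have [k] := loxodromic_unbounded 1 gl n0.
by rewrite gn expg1n action1 mdistxx ler10.
Qed.

End loxodromic.

(** * Escape of the walk *)

Section escape.
Context {R : realType} {G : groupType} {X : metricType R}.
Variables (act : isometric_action G X) (o : X) (mu : G -> R).
Hypotheses (hmu : probability_weights mu) (hsym : symmetric_weights mu).
Notation mun := (convolution_power mu).

Lemma balanced_power_support (g : G) m K i : (i <= K)%N ->
  0 < mun m g -> 0 < mun (m * K) (balanced_power g K i).
Proof.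
move=> iK mg; rewrite -(subnKC iK) mulnDr /balanced_power subnKC//.
apply: convolution_powerM_gt0 => //; first exact: convolution_powerX_gt0.
by rewrite convolution_powerV//; exact: convolution_powerX_gt0.
Qed.

(** The weights of the convolution powers tend to zero uniformly. *)
Lemma convolution_power_cvg0 (g : G) : loxodromic act g ->
  generated_semigroup (support_weights mu) g ->
  forall e : R, 0 < e -> exists N, forall n x, (N <= n)%N -> mun n x <= e.
Proof.
move=> gl /(generated_semigroup_power hmu)[m mg].
have hw := convolution_power_weights hmu.
apply: (@no_concentration _ _ mu hmu _ (fun a x => a^-1 * x)%g).
- by move=> n x; exact: (hw n).1.
- by move=> n s; exact: weights_sum_le1.
- by move=> k n x; exact: convolution_powerD.
move=> K; exists (m.+1 * K)%N, [seq balanced_power g K i | i <- iota 0 K.+1]; split.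
  move=> a /mapP[i]; rewrite mem_iota /= add0n ltnS => iK ->.
  exact: balanced_power_support.
move=> x; rewrite -map_comp undup_id ?size_map ?size_iota//.
apply: (@balanced_orbit_uniq _ _ (fun a y => a * y)%g g x K).
- exact: mul1g.
- by move=> a b; rewrite mulgA.
- by move=> a y z; exact: mulgI.
- move=> n n0 /(congr1 (fun y => y * x^-1)%g); rewrite mulgK mulgV.
  exact: loxodromic_torsion_free gl n0.
Qed.

Hypotheses (hfin : finite_balls X) (hproper : proper_action act).

Lemma finite_orbit_ball (D : R) : finite_set [set g | mdist (act g o) o <= D].
Proof.
have [D0|D0] := ltP D 0.
  rewrite (_ : [set g | _] = set0); first exact: finite_set0.
  apply/seteqP; split=> g //= h; have := mdist_ge0 (act g o) o; lra.
pose B := [set y | mdist o y <= D].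
have cB : compact B by apply: finite_compact; exact: hfin.
apply: sub_finite_set (hproper cB) => g /= gD.
exists (act g o); split; last by rewrite /B /= metric_sym.
by exists o => //; rewrite /B /= mdistxx.
Qed.

Lemma walk_escapes (g : G) : loxodromic act g ->
  generated_semigroup (support_weights mu) g ->
  forall D e : R, 0 < e -> exists N, forall n, (N <= n)%N ->
    mean (mun n) \1_[set a | mdist (act a o) o <= D] <= e.
Proof.
move=> gl gs D e e0; have hw := convolution_power_weights hmu.
have /finite_seqP[s0 Ds0] := finite_orbit_ball D.
pose s := undup s0; have us : uniq s by exact: undup_uniq.
have Ds : [set a | mdist (act a o) o <= D] = [set` s].
  by rewrite Ds0; apply/seteqP; split => x /=; rewrite /s mem_undup.
have cA : 0 < e / (size s).+1%:R by rewrite divr_gt0.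
have [N hN] := convolution_power_cvg0 gl gs cA; exists N => n Nn.
rewrite Ds -lee_fin -ge0_esum_mean//; last exact: bounded_function_indic.
have -> : \esum_(a in [set: G]) ((\1_[set` s] a : R) * mun n a)%:E
    = \esum_(a in [set` s]) (mun n a)%:E.
  rewrite [RHS]esum_mkcond; apply: eq_esum => a _; rewrite indicE.
  by case: (_ \in _); rewrite ?mul1r ?mul0r.
rewrite esum_fset//; last 2 first.
- exact: finite_seq.
- by move=> a _; rewrite lee_fin (hw n).1.
rewrite -fsbig_seq// sumEFin lee_fin.
apply: le_trans (_ : \sum_(a <- s) (e / (size s).+1%:R) <= _).
  by apply: ler_sum => a _; exact: hN.
rewrite big_const_seq count_predT iter_addr addr0 -[leLHS]mulr_natl.
rewrite mulrCA; apply: ler_piMr; first exact: ltW.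
by rewrite ler_pdivrMr// mul1r ler_nat.
Qed.

End escape.

(** * Stationary measures have no atoms *)

Section boundary_measure.
Context {R : realType} {G : groupType} {X : metricType R}.
Variables (act : isometric_action G X) (o : X) (xi0 : boundary o).
Context (delta : R) (hyp : delta_hyperbolic X delta).
Notation bdry := (borel_boundary xi0).

Lemma boundary_open_measurable (A : set (boundary o)) :
  open A -> measurable (A : set bdry).
Proof. by move=> oA; exact: sub_sigma_algebra. Qed.

Lemma boundary_act_open g (A : set (boundary o)) :
  open A -> open (boundary_act act g @^-1` A).
Proof.
move=> /(boundary_openP hyp) oA; apply/(boundary_openP hyp) => xi u /= Agxi xu.
have [r hr] := oA _ _ Agxi (boundary_class_act act g xu).
exists (r + mdist (act g o) o) => eta v ev uv.
apply: (hr _ _ (boundary_class_act act g ev)).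
by have := near_at_act act g uv; rewrite addrK.
Qed.

Lemma boundary_act_measurable g (A : set bdry) : measurable A ->
  measurable ((boundary_act act g : bdry -> bdry) @^-1` A).
Proof.
move=> mA; rewrite -[X in measurable X]setTI.
have : measurable_fun setT (boundary_act act g : bdry -> bdry).
  apply: (@measurability _ _ bdry bdry setT _ (@open (boundary o))) => //.
  move=> _ [B oB <-]; rewrite setTI; apply: boundary_open_measurable.
  exact: boundary_act_open.
by apply.
Qed.

Lemma boundary_set1_measurable (xi : boundary o) : measurable ([set xi] : set bdry).
Proof.
rewrite -[X in measurable X]setCK; apply: measurableC.
apply: boundary_open_measurable; apply/(boundary_openP hyp) => eta u ne eu.
have [v xv] := boundary_class_ex xi.
have [r nr] : exists r, ~ near_at o r u v.
  apply: contra_notP ne => h; apply: (boundary_asymptotic_eq hyp eu xv) => r.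
  by apply: contrapT => nr; apply: h; exists r.
exists (r + delta) => zeta w zw uw zxi; apply: nr.
rewrite zxi in zw.
apply: near_at_sym; apply: (asymptotic_near_at hyp _ _ (near_at_sym uw)) => //.
exact: (boundary_class_asymptotic hyp xv zw).
Qed.

Lemma boundary_act_preimage1 g (xi : boundary o) :
  boundary_act act g @^-1` [set xi] = [set boundary_act act g^-1%g xi].
Proof.
by apply/seteqP; split=> eta /= => [<-|->];
  rewrite -boundary_actM ?mulVg ?mulgV boundary_act1.
Qed.

Context (mu : G -> R) (nu : probability bdry R).
Hypotheses (hmu : probability_weights mu) (hsym : symmetric_weights mu).
Hypothesis hnu : stationary act mu nu.
Notation mun := (convolution_power mu).

(** Real-valued measure of a set of boundary points. *)
Definition mass (A : set (boundary o)) : R := fine (nu (A : set bdry)).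

Lemma massE (A : set bdry) : measurable A -> nu A = (mass A)%:E.
Proof. by move=> mA; rewrite /mass fineK// fin_num_measure. Qed.

Lemma mass_ge0 A : 0 <= mass A.
Proof. exact: fine_ge0. Qed.

Lemma mass_le1 (A : set bdry) : measurable A -> mass A <= 1.
Proof. by move=> mA; rewrite -lee_fin -massE// probability_le1. Qed.

(** A [mu]-stationary measure is stationary for all the convolution powers. *)
Lemma stationary_power n (A : set bdry) : measurable A ->
  mass A = mean (mun n) (fun g => mass (boundary_act act g @^-1` A)).
Proof.
have bm (B : set bdry) : measurable B ->
    bounded_function (fun g => mass (boundary_act act g @^-1` B)).
  move=> mB; exists 1 => g; rewrite ger0_norm ?mass_ge0// mass_le1//.
  exact: boundary_act_measurable.
have st (B : set bdry) : measurable B ->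
    mass B = mean mu (fun g => mass (boundary_act act g @^-1` B)).
  move=> mB; apply: EFin_inj; rewrite -massE// -hnu// -ge0_esum_mean//; last 2 first.
  - exact: bm.
  - by move=> g; exact: mass_ge0.
  apply: eq_esum => g _; rewrite EFinM muleC; congr (_ * _)%E.
  by rewrite /pushforward massE//; exact: boundary_act_measurable.
elim: n A => [|n ih] A mA.
  rewrite mean_power0//; last exact: bm.
  congr mass; apply/seteqP; split=> xi /=; by rewrite boundary_act1.
rewrite -addn1 mean_powerD//; last exact: bm.
rewrite [LHS](ih _ mA); congr mean; apply/funext => a.
rewrite (mean_power1 hmu); last first.
  exact: (bounded_function_comp (fun b => a * b)%g (bm _ mA)).
rewrite st; last exact: boundary_act_measurable.
congr mean; apply/funext => b; congr mass; apply/seteqP.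
by split=> xi /=; rewrite boundary_actM.
Qed.

Hypothesis hne : nonelementary act o (generated_semigroup (support_weights mu)).

(** A stationary measure has no atoms: each boundary point is moved by one of two
    loxodromic elements, hence has arbitrarily many images under its powers, and
    [no_concentration] applies to the masses of points. *)
Lemma stationary_no_atom (xi : boundary o) : nu ([set xi] : set bdry) = 0%E.
Proof.
have m1 (x : boundary o) : measurable ([set x] : set bdry) by exact: boundary_set1_measurable.
rewrite massE//; congr EFin; apply/eqP; rewrite eq_le mass_ge0 andbT.
apply/ler_addgt0Pl => e e0; rewrite addr0.
have [g [h [gs hs gl hl gh]]] := hne.
(* g ^+ l.+1 and h ^+ k.+1 belong to the support of the same convolution power *)
have [k kg] := generated_semigroup_power hmu gs.
have [l lh] := generated_semigroup_power hmu hs.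
suff [N hN] : exists N, forall (n : nat) x, (N <= n)%N -> mass [set x] <= e.
  exact: (hN N _ (leqnn _)).
pose op (a : G) (x : boundary o) := boundary_act act a^-1%g x.
apply: (@no_concentration _ _ mu hmu _ op (fun _ x => mass [set x])) => //.
- by move=> _ x; exact: mass_ge0.
- move=> _ s us; rewrite -lee_fin -sumEFin.
  rewrite (eq_bigr (fun x => nu ([set x] : set bdry))); last by move=> x _; rewrite massE.
  rewrite fsbig_seq// -(@measure_fin_bigcup _ _ _ nu _ [set` s] (fun x => [set x]))//.
  + by apply: probability_le1; apply: fin_bigcup_measurable => //; exact: finite_seq.
  + exact: finite_seq.
  + by move=> x y _ _ [z [-> ->]].
- move=> m n x; rewrite (stationary_power m (m1 x)); congr mean; apply/funext => a.
  by rewrite boundary_act_preimage1.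
move=> K; pose m := (k.+1 * l.+1)%N.
have mg : 0 < mun m (g ^+ l.+1)%g by exact: convolution_powerX_gt0.
have mh : 0 < mun m (h ^+ k.+1)%g by rewrite /m mulnC; exact: convolution_powerX_gt0.
pose S := [seq balanced_power (g ^+ l.+1)%g K i | i <- iota 0 K.+1]
  ++ [seq balanced_power (h ^+ k.+1)%g K i | i <- iota 0 K.+1].
exists (m * K)%N, S; split.
  move=> a; rewrite mem_cat => /orP[] /mapP[i]; rewrite mem_iota /= add0n ltnS => iK ->;
    exact: balanced_power_support.
move=> x.
have many (b : G) n : loxodromic act b -> boundary_act act b x <> x ->
    uniq [seq op (balanced_power (b ^+ n.+1)%g K i) x | i <- iota 0 K.+1].
  move=> bl bx; apply: (@balanced_orbit_uniq _ _ (fun a (y : boundary o) => boundary_act act a y)).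
  - exact: boundary_act1.
  - by move=> ? ?; exact: boundary_actM.
  - move=> a y z /(congr1 (boundary_act act a^-1%g)).
    by rewrite -!boundary_actM mulVg !boundary_act1.
  move=> j j0; rewrite -expgnA => fixx; apply: bx; move: fixx.
  apply: (boundary_fixed_root hyp) => M.
  by apply: loxodromic_unbounded => //; rewrite muln_gt0 /=.
have big s : uniq s -> size s = K.+1 -> {subset s <= [seq op a x | a <- S]} ->
    (K <= size (undup [seq op a x | a <- S]))%N.
  move=> us sK sub; apply: ltnW; rewrite -sK; apply: uniq_leq_size => // y ys.
  by rewrite mem_undup; exact: sub.
have [gx|/(many _ l gl) u] := pselect (boundary_act act g x = x); last first.
  apply: big u _ _; first by rewrite size_map size_iota.
  by move=> y ys; rewrite map_cat mem_cat -map_comp ys.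
have [hx|/(many _ k hl) u] := pselect (boundary_act act h x = x); last first.
  apply: big u _ _; first by rewrite size_map size_iota.
  by move=> y ys; rewrite map_cat mem_cat -!map_comp ys orbT.
by suff : @set0 (boundary o) x by []; rewrite -gh; split.
Qed.

End boundary_measure.

(** * Integrals of bounded functions *)

Section bounded_integral.
Context {d : measure_display} {T : measurableType d} {R : realType}.
Variable P : probability T R.
Implicit Types (f : T -> R) (A : set T).

Lemma bounded_measurable_integrable f (M : R) : measurable_fun setT f ->
  (forall x, `|f x| <= M) -> P.-integrable setT (EFin \o f).
Proof.
move=> mf hM; apply: measurable_bounded_integrable => //.
  by apply: le_lt_trans (probability_le1 _ _) _; rewrite ?ltry.
by exists M; split; [exact: num_real|move=> y My x _; exact: le_trans (hM x) (ltW My)].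
Qed.

Lemma Rintegral_probability_cst (c : R) : \int[P]_x c = c.
Proof. by rewrite Rintegral_cst//= [X in fine X]probability_setT mulr1. Qed.

Lemma Rintegral_indic A : measurable A -> \int[P]_x (\1_A x) = fine (P A).
Proof. by move=> mA; rewrite /Rintegral integral_indic// setIT. Qed.

Lemma Rintegral_near_cst f (c e B : R) (U : set T) : measurable_fun setT f ->
  measurable U -> 0 <= e -> (forall x, ~ U x -> `|f x - c| <= e) ->
  (forall x, `|f x - c| <= B) -> `|\int[P]_x f x - c| <= e + B * fine (P U).
Proof.
move=> mf mU e0 he hB; have B0 : 0 <= B by apply: le_trans (normr_ge0 _) (hB point).
have ig : P.-integrable setT (EFin \o (fun x => f x - c)).
  by apply: (bounded_measurable_integrable (M := B)) => //; exact: measurable_funB.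
have iU (k : R) : P.-integrable setT (EFin \o (fun x => k * \1_U x)).
  apply: (bounded_measurable_integrable (M := `|k|)).
    exact: measurable_funM.
  move=> x; rewrite normrM indicE; case: (_ \in _); rewrite ?normr1 ?normr0 ?mulr1//.
  by rewrite mulr0.
have ic (k : R) : P.-integrable setT (EFin \o (fun=> k)).
  exact: (bounded_measurable_integrable (M := `|k|)).
have if_ : P.-integrable setT (EFin \o f).
  apply: (bounded_measurable_integrable (M := B + `|c|)) => // x.
  by rewrite -[f x](subrK c); apply: le_trans (ler_normD _ _) _; rewrite lerD2r.
rewrite -[X in `|_ - X|]Rintegral_probability_cst -RintegralB//.
apply: le_trans (le_normr_Rintegral _ _) _ => //.
rewrite -[X in X + _](Rintegral_probability_cst e) -Rintegral_indic//.
rewrite -RintegralZl//; last first.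
  by have := iU 1; rewrite (_ : (fun x => 1 * _) = \1_U)//; apply/funext => x; rewrite mul1r.
rewrite -RintegralD//; apply: le_Rintegral => //.
- apply: (bounded_measurable_integrable (M := B)); last by move=> x; rewrite normr_id.
  by apply: measurableT_comp => //; exact: measurable_funB.
- have := integrableD _ (ic e) (iU B); apply => //.
move=> x _; rewrite indicE; have [|/negP] := boolP (x \in U); last first.
  by rewrite inE mulr0 addr0 => /he.
by rewrite mulr1 => _; apply: le_trans (hB x) _; rewrite lerDr.
Qed.

Lemma sum_indicator_trunc (K : nat) (y : R) : 0 <= y -> y <= K%:R ->
  y - 1 <= \sum_(i < K) (i.+1%:R <= y)%R%:R <= y.
Proof.
move=> y0 yK; have /andP[h1 h2] := Num.Theory.truncn_itv y0.
set t := Num.Def.trunc y in h1 h2.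
have tK : (t <= K)%N by rewrite -(ler_nat R); exact: le_trans h1 yK.
have -> : \sum_(i < K) (i.+1%:R <= y)%R%:R = t%:R :> R.
  rewrite (eq_bigr (fun i : 'I_K => (i < t)%N%:R)); last first.
    by move=> i _; rewrite /t Num.Theory.truncn_gt_nat.
  rewrite -natr_sum; congr _%:R; rewrite -(big_mkord xpredT (fun i => nat_of_bool (i < t)%N)).
  rewrite (big_cat_nat _ tK)//= [X in (_ + X)%N]big_nat_cond [X in (_ + X)%N]big1 ?addn0.
    rewrite big_nat_cond (eq_bigr (fun=> 1%N)); first by rewrite -big_nat_cond sum_nat_const_nat subn0 muln1.
    by move=> i /andP[/andP[_ ->]].
  by move=> i /andP[/andP[ti _] _]; rewrite ltnNge ti.
by rewrite h1 andbT lerBlDr natr1 ltW.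
Qed.

(** A bounded function is determined within [N^-1] by the measures of its
    superlevel sets. *)
Lemma layer_cake f (N K : nat) : measurable_fun setT f -> (0 < N)%N ->
  (forall x, 0 <= f x) -> (forall x, N%:R * f x <= K%:R) ->
  `|\int[P]_x f x - N%:R^-1 * \sum_(i < K) fine (P [set x | i.+1%:R <= N%:R * f x])|
    <= N%:R^-1.
Proof.
move=> mf N0 f0 fK; have N0' : 0 < N%:R :> R by rewrite ltr0n.
pose A (i : nat) := [set x | i.+1%:R <= N%:R * f x].
have mA i : measurable (A i).
  rewrite -[X in measurable X]setTI; apply: measurable_fun_ler => //.
  exact: measurable_funM.
pose h (x : T) : R := N%:R^-1 * \sum_(i < K) \1_(A i) x.
have hf x : f x - N%:R^-1 <= h x <= f x.
  have := @sum_indicator_trunc K (N%:R * f x) (mulr_ge0 (ltW N0') (f0 x)) (fK x).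
  have -> : \sum_(i < K) (i.+1%:R <= N%:R * f x)%R%:R = \sum_(i < K) \1_(A i) x :> R.
    apply: eq_bigr => i _; rewrite indicE; congr (nat_of_bool _)%:R.
    by apply/idP/idP; rewrite inE.
  rewrite /h => /andP[h1 h2]; apply/andP; split.
    by rewrite ler_pdivlMl// mulrBr mulfV ?gt_eqF.
  by rewrite ler_pdivrMl.
have int_h n : P.-integrable setT (EFin \o (fun x => \sum_(i < n) \1_(A i) x : R))
  /\ \int[P]_x (\sum_(i < n) \1_(A i) x) = \sum_(i < n) fine (P (A i)).
  have i1 i : P.-integrable setT (EFin \o (\1_(A i) : T -> R)).
    apply: (bounded_measurable_integrable (M := 1)) => // x.
    by rewrite indicE; case: (_ \in _); rewrite ?normr1 ?normr0.
  elim: n => [|n [ih1 ih2]].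
    rewrite (_ : (fun x => _) = cst 0); last by apply/funext => x; rewrite big_ord0.
    rewrite Rintegral_probability_cst big_ord0; split=> //.
    by apply: (bounded_measurable_integrable (M := 0)) => // x; rewrite normr0.
  rewrite (_ : (fun x => _) =
    (fun x => \sum_(i < n) \1_(A i) x : R) \+ \1_(A n)); last first.
    by apply/funext => x; rewrite big_ord_recr.
  split; first by have := integrableD measurableT ih1 (i1 n); apply.
  by rewrite big_ord_recr/= -ih2 -Rintegral_indic// -RintegralD.
have [i1 i2] := int_h K.
have if_ : P.-integrable setT (EFin \o f).
  apply: (bounded_measurable_integrable (M := N%:R^-1 * K%:R)) => // x.
  by rewrite ger0_norm// ler_pdivlMl.
have ih : P.-integrable setT (EFin \o h).
  by have := integrableZl measurableT N%:R^-1 i1; apply.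
rewrite -i2 -RintegralZl// -RintegralB//.
apply: le_trans (le_normr_Rintegral _ _) _ => //.
  by have := integrableB measurableT if_ ih; apply.
rewrite -[leRHS]Rintegral_probability_cst; apply: le_Rintegral => //.
- by have := integrable_abse (integrableB measurableT if_ ih); apply.
- by apply: (bounded_measurable_integrable (M := `|N%:R^-1|)).
move=> x _; have /andP[h1 h2] := hf x.
by rewrite ger0_norm ?subr_ge0// lerBlDr addrC -lerBlDr.
Qed.


Lemma layer_cake_shift f (M : R) (N K : nat) : measurable_fun setT f -> (0 < N)%N ->
  (forall x, `|f x| <= M) -> N%:R * (M + M) <= K%:R ->
  `|\int[P]_x f x
    - (N%:R^-1 * \sum_(i < K) fine (P [set x | i.+1%:R <= N%:R * (f x + M)]) - M)|
    <= N%:R^-1.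
Proof.
move=> mf N0 fM MK; have N0' : 0 < N%:R :> R by rewrite ltr0n.
have mg : measurable_fun setT (fun x => f x + M) by exact: measurable_funD.
have g0 x : 0 <= f x + M.
  by have := fM x; rewrite ler_norml => /andP[]; lra.
have gK x : N%:R * (f x + M) <= K%:R.
  apply: le_trans MK; rewrite ler_pM2l// lerD2r.
  by have := fM x; rewrite ler_norml => /andP[].
have := layer_cake mg N0 g0 gK; rewrite RintegralD//; last 2 first.
- exact: bounded_measurable_integrable fM.
- exact: (bounded_measurable_integrable (M := `|M|)).
by rewrite Rintegral_probability_cst opprB addrA.
Qed.

End bounded_integral.

(** * Convergence of the walk *)

Section convergence.
Context {R : realType} {G : groupType} {X : metricType R}.
Variables (act : isometric_action G X) (o : X) (xi0 : boundary o).
Context (mu : G -> R) (nu : probability (borel_boundary xi0) R).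
Context (delta : R) (hyp : delta_hyperbolic X delta).
Hypotheses (hfin : finite_balls X) (hgeo : roughly_geodesic X)
  (hproper : proper_action act).
Hypotheses (hmu : probability_weights mu) (hsym : symmetric_weights mu).
Hypothesis hne : nonelementary act o (generated_semigroup (support_weights mu)).
Hypothesis hnu : stationary act mu nu.
Notation mun := (convolution_power mu).
Notation bdry := (borel_boundary xi0).
Notation mass := (mass nu).

(** The interior of the set of the boundary points that are close to [u] at level
    [r], an open set that contains those close to [u] at level [r + delta]. *)
Definition inner_shadow (r : R) (u : nat -> X) : set (boundary o) :=
  [set eta | exists s v, boundary_class eta v /\ forall (zeta : boundary o) w,
     boundary_class zeta w -> near_at o s v w -> near_at o r u w].

Lemma inner_shadow_open r u : open (inner_shadow r u).
Proof.
apply/(boundary_openP hyp) => eta v' [s [v [ev hv]]] ev'.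
exists (s + delta + delta) => zeta w zw v'w; exists (s + delta), w; split=> // theta t tt wt.
apply: (hv _ _ tt); apply: (near_at_trans_le hyp (r := s + delta) _ _ _ wt) => //.
apply: (asymptotic_near_at hyp _ _ v'w) => //.
exact: (boundary_class_asymptotic hyp ev ev').
Qed.

Lemma inner_shadow_sub r u eta v : inner_shadow r u eta -> boundary_class eta v ->
  near_at o r u v.
Proof.
move=> [s [v' [ev' h]]] ev; apply: (h _ _ ev).
exact: (boundary_class_asymptotic hyp ev' ev).
Qed.

Lemma sub_inner_shadow r u eta v : boundary_class eta v ->
  near_at o (r + delta) u v -> inner_shadow r u eta.
Proof.
move=> ev uv; exists (r + delta), v; split=> // zeta w zw vw.
exact: (near_at_trans_le hyp _ _ uv vw).
Qed.

Lemma inner_shadow_le r s u : s <= r -> inner_shadow r u `<=` inner_shadow s u.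
Proof.
move=> sr eta [t [v [ev h]]]; exists t, v; split=> // zeta w zw vw.
exact: near_at_le sr (h _ _ zw vw).
Qed.

(** The shadows of a boundary point decrease to this point, which is not an
    atom. *)
Lemma inner_shadow_mass_cvg0 (xi : boundary o) u (e : R) : boundary_class xi u -> 0 < e ->
  exists n : nat, mass (inner_shadow n%:R u) <= e.
Proof.
move=> xu e0; pose U (n : nat) : set bdry := inner_shadow n%:R u.
have mU n : measurable (U n).
  exact: boundary_open_measurable (inner_shadow_open _ _).
have capU : \bigcap_n U n = [set xi].
  apply/seteqP; split=> [eta hU|eta -> n _]; last first.
    apply: (sub_inner_shadow xu).
    exact: (boundary_class_asymptotic hyp xu xu).
  have [v ev] := boundary_class_ex eta.
  apply: (boundary_asymptotic_eq hyp ev xu); apply: asymptotic_sym => r.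
  have [N /(_ N (leqnn _)) hN] := ex_natr_ge r.
  exact: near_at_le hN (inner_shadow_sub (hU N I) ev).
have : nu \o U @ \oo --> nu (\bigcap_n U n).
  apply: nonincreasing_cvg_mu => //.
  - by apply: le_lt_trans (probability_le1 _ _) _; rewrite ?ltry.
  - by rewrite capU; exact: boundary_set1_measurable.
  - move=> m n mn; apply/subsetPset; apply: inner_shadow_le; by rewrite ler_nat.
rewrite capU (stationary_no_atom hyp hmu hsym hnu hne) => /fine_cvgP[_].
move=> /cvgrPdist_le/(_ e e0)[N _ /(_ N (leqnn _))] /=.
by rewrite sub0r normrN ger0_norm ?mass_ge0// => h; exists N.
Qed.

(** The set of boundary points seen from [o] close to [x] at level [r] has small
    measure, uniformly in [x]; the measurable set [U] stands in for this set, which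
    need not be measurable. *)
Lemma shadow_mass_small (e : R) : 0 < e -> exists r : R, forall x : X,
  exists U : set bdry, [/\ measurable U, mass U <= e & forall (eta : boundary o) v,
    boundary_class eta v -> near_at o r v (cst x) -> U eta].
Proof.
move=> e0; apply: contrapT => nr.
have /choice[x hx] : forall n : nat, exists x : X, forall U : set bdry,
    measurable U -> (forall (eta : boundary o) v, boundary_class eta v ->
      near_at o (n%:R + delta) v (cst x) -> U eta) -> e < mass U.
  move=> n; apply: contra_notP nr => nx; exists (n%:R + delta) => x.
  apply: contra_notP nx => nU; exists x => U mU hU; rewrite ltNge.
  by apply/negP => Ue; apply: nU; exists U.
have xself n : near_at o n%:R (cst (x n)) (cst (x n)).
  apply: contrapT => ns; have := hx n set0 measurable0.
  rewrite /mass measure0 /= => h; suff : e < 0 by rewrite ltNge ltW.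
  apply: h => eta v ev vx; apply: ns; exact: (near_at_self hyp (near_at_sym vx)).
have [xi [u [xu hu]]] := boundary_cluster hyp hfin hgeo xself.
have [k hk] := inner_shadow_mass_cvg0 xu e0.
have d0 := ler_norm delta; have d1 := normr_ge0 delta.
have [N hN] := ex_natr_ge (k%:R + `|delta|).
have [n Nn un] := hu (k%:R + 2 * `|delta|) N.
have : e < mass (inner_shadow k%:R u).
  apply: (hx n); first exact: boundary_open_measurable (inner_shadow_open _ _).
  move=> eta v ev vx; apply: (sub_inner_shadow ev).
  apply: (near_at_trans_le hyp _ _ un (near_at_sym vx)); first lra.
  by have := hN _ Nn; lra.
by rewrite ltNge hk.
Qed.

Let hw n : probability_weights (mun n). Proof. exact: convolution_power_weights. Qed.

Let ball_indic (D : R) : G -> R := \1_[set a | mdist (act a o) o <= D].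

Let escape (D e : R) : 0 < e -> exists N, forall n, (N <= n)%N ->
  mean (mun n) (ball_indic D) <= e.
Proof.
move=> e0; have [g [h [gs hs gl hl gh]]] := hne.
exact: (walk_escapes o hmu hsym hfin hproper gl gs D e0).
Qed.

Lemma mass_setC (A : set bdry) : measurable A -> mass (~` A) = 1 - mass A.
Proof.
move=> mA; apply: EFin_inj; rewrite -massE; last exact: measurableC.
by rewrite probability_setC// massE.
Qed.

Lemma mass_le (A B : set bdry) : measurable A -> measurable B -> A `<=` B ->
  mass A <= mass B.
Proof. by move=> mA mB AB; rewrite -lee_fin -!massE// le_measure ?inE. Qed.

(** The walk avoids the shadow of each [y] with high probability, uniformly in
    [y]: if [a o] is far away and close to [y], then [a] sends most of the boundary
    close to [a o], hence close to [y], so that this event cannot be more likely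
    than about the measure of the shadow of [y]. *)
Lemma walk_avoids_shadow (e : R) : 0 < e -> exists (r : R) N, forall n y, (N <= n)%N ->
  mean (mun n) \1_[set a | r <= gromov_product o (act a o) y] <= e.
Proof.
(* the probability p satisfies (1 - e') p <= 2 e', where 1 - e' >= 1 / 2 *)
move=> e0; pose e' := Num.min (e / 4) (1 / 2).
have e'0 : 0 < e' by rewrite lt_min !divr_gt0.
have e'e : e' <= e / 4 by rewrite ge_min lexx.
have e'2 : e' <= 1 / 2 by rewrite ge_min lexx orbT.
have [r hr] := shadow_mass_small e'0.
have d0 := ler_norm delta; have d1 := normr_ge0 delta.
pose D := 2 * `|r| + 3 * `|delta|.
have r0 := ler_norm r; have r1 := normr_ge0 r.
have [N hN] := escape D e'0.
exists (r + delta), N => n y Nn.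
have [U [mU Ue hU]] := hr y.
set A := [set a | _].
pose p a := mass (boundary_act act a @^-1` U).
have p0 a : 0 <= p a by exact: mass_ge0.
have mp a : measurable (boundary_act act a @^-1` U : set bdry).
  exact: boundary_act_measurable.
have bp : bounded_function p.
  by exists 1 => a; rewrite ger0_norm// mass_le1.
have key a : (1 - e') * \1_A a <= ball_indic D a + p a.
  have b0 : 0 <= ball_indic D a by rewrite /ball_indic indicE.
  rewrite indicE; have [|_] := boolP (a \in A); last by rewrite mulr0 addr_ge0.
  rewrite inE mulr1 /A /= => aA.
  have [aD|Da] := leP (mdist (act a o) o) D.
    have -> : ball_indic D a = 1 by rewrite /ball_indic indicE mem_set.
    by have := p0 a; lra.
  have [V [mV Ve hV]] := hr (act a^-1%g o).
  suff VU : ~` V `<=` boundary_act act a @^-1` U.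
    have := mass_le (measurableC mV) (mp a) VU; rewrite mass_setC// -/(p a).
    lra.
  move=> eta Veta; have [v ev] := boundary_class_ex eta.
  apply: (hU _ _ (boundary_class_act act a ev)).
  have := near_at_act_orbit hyp (boundary_class_asymptotic hyp ev ev)
    (fun h => Veta (hV _ _ ev h)).
  move=> h; apply: (near_at_trans_le hyp _ _ h ((near_at_cst o _ _ _).2 aA)) => //.
  by rewrite /D in Da; lra.
have : (1 - e') * mean (mun n) \1_A <= e' + e'.
  rewrite -meanZ//; last exact: bounded_function_indic.
  apply: le_trans (_ : mean (mun n) (ball_indic D \+ p) <= _).
    apply: mean_le => //.
    - apply: (@bounded_function_mul _ _ (cst (1 - e'))); first exact: bounded_function_cst.
      exact: bounded_function_indic.
    - by apply: bounded_function_add => //; exact: bounded_function_indic.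
  rewrite meanD//; last exact: bounded_function_indic.
  rewrite lerD ?hN//.
  by rewrite -(stationary_power hyp hmu hnu n mU).
have m0 : 0 <= mean (mun n) \1_A by apply: mean_ge0 => // a; rewrite indicE.
have : 1 / 2 * mean (mun n) \1_A <= (1 - e') * mean (mun n) \1_A.
  by apply: ler_wpM2r => //; lra.
lra.
Qed.

(** Stationarity for functions instead of sets, by comparison of the superlevel
    sets. *)
Lemma stationary_integral n (f : bdry -> R) (M : R) : measurable_fun setT f ->
  (forall xi, `|f xi| <= M) ->
  \int[nu]_xi f xi = mean (mun n) (fun g => \int[nu]_xi f (boundary_act act g xi)).
Proof.
move=> mf fM; have M0 : 0 <= M by apply: le_trans (normr_ge0 _) (fM xi0).
pose I g := \int[nu]_xi f (boundary_act act g xi).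
have mfg g : measurable_fun setT (fun xi : bdry => f (boundary_act act g xi)).
  apply: (measurableT_comp mf) => _ B mB; rewrite setTI.
  exact: boundary_act_measurable.
have bI : bounded_function I.
  exists (M + M * 0) => g; have := @Rintegral_near_cst _ _ _ nu
    (fun xi => f (boundary_act act g xi)) 0 M M set0 (mfg g) measurable0 M0.
  rewrite subr0 measure0; apply=> xi; rewrite ?subr0//.
apply/eqP; rewrite -subr_eq0 -normr_eq0; apply/eqP/le_anti; rewrite normr_ge0 andbT.
apply/ler_addgt0Pl => e e0; rewrite addr0.
have [N0 /(_ N0 (leqnn _)) hN0] := ex_natr_ge (2 / e).
pose N := N0.+1; have N_gt0 : 0 < N%:R :> R by rewrite ltr0n.
have Ne : N%:R^-1 + N%:R^-1 <= e.
  rewrite -mulr2n -[leLHS]mulr_natl ler_pdivrMr// mulrC -ler_pdivrMr//.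
  by apply: le_trans hN0 _; rewrite ler_nat.
have [K /(_ K (leqnn _)) hK] := ex_natr_ge (N%:R * (M + M)).
pose A i : set bdry := [set xi | i.+1%:R <= N%:R * (f xi + M)].
have mA i : measurable (A i).
  rewrite -[X in measurable X]setTI; apply: measurable_fun_ler => //.
  by apply: measurable_funM => //; exact: measurable_funD.
pose F i g := mass (boundary_act act g @^-1` A i).
have bF i : bounded_function (F i).
  exists 1 => g; rewrite ger0_norm ?mass_ge0// mass_le1//.
  exact: boundary_act_measurable.
have [bS hS] := mean_sum (hw n) K bF.
pose S g := N%:R^-1 * \sum_(i < K) F i g - M.
have bNS : bounded_function (fun g => N%:R^-1 * \sum_(i < K) F i g).
  by apply: (@bounded_function_mul _ _ (cst N%:R^-1)) => //; exact: bounded_function_cst.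
have bS' : bounded_function S.
  apply: (@bounded_function_add _ _ _ (cst (- M))) => //; exact: bounded_function_cst.
have meanS : mean (mun n) S = N%:R^-1 * \sum_(i < K) mass (A i) - M.
  rewrite /S meanB//; last exact: bounded_function_cst.
  rewrite [X in _ - X]mean_cst// meanZ// hS; congr (_ * _ - _).
  by apply: eq_bigr => i _; rewrite -(stationary_power hyp hmu hnu n (mA i)).
have h1 := @layer_cake_shift _ _ _ nu f M N K mf (ltn0Sn _) fM hK.
have h2 : `|mean (mun n) I - mean (mun n) S| <= N%:R^-1.
  rewrite -meanB//; apply: mean_bound => // g.
  exact: (@layer_cake_shift _ _ _ nu _ M N K (mfg g) (ltn0Sn _) (fun xi => fM _) hK).
rewrite -(subrK (mean (mun n) S) (\int[nu]_xi f xi)) -addrA.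
apply: le_trans (ler_normD _ _) _; apply: le_trans Ne.
by rewrite lerD// ?meanS// -meanS distrC.
Qed.

Section limit.
Variables (F : compactification o -> R) (M : R).
Hypotheses (cF : continuous F) (FM : forall a, `|F a| <= M).

Lemma continuous_boundary_measurable :
  measurable_fun setT ((fun xi => F (Bdry xi)) : bdry -> R).
Proof.
apply: (measurability _ (RGenOInfty.measurableE R)) => //.
move=> _ [_ [a ->] <-]; rewrite setTI preimage_itvoy.
apply: boundary_open_measurable.
have /continuousP/(_ _ (@open_gt R a)) oF := cF.
by exists (F @^-1` [set x | a < x]).
Qed.

Let M0 : 0 <= M. Proof. by apply: le_trans (normr_ge0 _) (FM (Inner o)). Qed.

Let FB a b : `|F a - F b| <= 2 * M.
Proof.
by apply: le_trans (ler_normB _ _) _; have := FM a; have := FM b; lra.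
Qed.

Let small (e : R) : 0 < e -> exists e' : R, 0 < e' /\ 2 * M * e' <= e.
Proof.
move=> e0; have m0 := M0; exists (e / (2 * (M + 1))); split; first by rewrite divr_gt0//; lra.
rewrite mulrA ler_pdivrMr; last lra.
by rewrite mulrC ler_wpM2l ?ltW//; lra.
Qed.

(** The law of the walk on the orbit of [o] converges weakly to the stationary
    measure: [F (b o)] differs little from the integral of [F (b xi)] over [xi] once
    [b o] is far away. *)
Lemma walk_cvg_stationary (e : R) : 0 < e -> exists N, forall n, (N <= n)%N ->
  `|mean (mun n) (fun b => F (Inner (act b o))) - \int[nu]_xi F (Bdry xi)| <= e.
Proof.
move=> e0; have e40 : 0 < e / 4 by rewrite divr_gt0.
have [e' [e'0 He']] := small e40.
have [r hr] := shadow_mass_small e'0.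
have [r1 hr1] := compactification_uniform_continuous hyp hfin hgeo cF e40.
have d0 := ler_norm delta; have d1 := normr_ge0 delta.
have rr0 := ler_norm r; have r11 := ler_norm r1.
pose D := `|r1| + `|r| + 2 * `|delta|.
have [N hN] := escape D e'0; exists N => n Nn.
have mf := continuous_boundary_measurable.
have mfg g : measurable_fun setT (fun xi : bdry => F (Bdry (boundary_act act g xi))).
  apply: (measurableT_comp mf) => _ B mB; rewrite setTI.
  exact: boundary_act_measurable.
rewrite (stationary_integral n mf (fun xi => FM _)).
set I := fun g => \int[nu]_xi F (Bdry (boundary_act act g xi)).
have key b : `|F (Inner (act b o)) - I b| <= e / 2 + 2 * M * ball_indic D b.
  rewrite distrC /ball_indic indicE.
  have [_|/negP bD] := boolP (b \in _).
    rewrite mulr1; have M20 : 0 <= 2 * M by rewrite mulr_ge0.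
    have := @Rintegral_near_cst _ _ _ nu _ (F (Inner (act b o))) (2 * M) (2 * M) set0
      (mfg b) measurable0 M20.
    rewrite measure0 mulr0 addr0 => h.
    by apply: le_trans (h (fun xi _ => FB _ _) (fun xi => FB _ _)) _; lra.
  rewrite mulr0 addr0; move: bD; rewrite inE /= => /negP; rewrite -ltNge => bD.
  have [U [mU Ue hU]] := hr (act b^-1%g o).
  have := @Rintegral_near_cst _ _ _ nu _ (F (Inner (act b o))) (e / 4) (2 * M) U
      (mfg b) mU (ltW e40).
  move=> h; apply: le_trans (h _ (fun xi => FB _ _)) _; last first.
    have := ler_wpM2l (mulr_ge0 (ler0n R 2) M0) Ue; rewrite /mass; lra.
  move=> eta Ueta; have [v ev] := boundary_class_ex eta; apply/ltW.
  apply: (hr1 _ _ (act b \o v) (cst (act b o))) => //.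
    exact: (boundary_class_act act b ev).
  have := near_at_act_orbit hyp (boundary_class_asymptotic hyp ev ev)
    (fun h => Ueta (hU _ _ ev h)).
  by apply: near_at_le; rewrite /D in bD; lra.
have bI : bounded_function (fun b => F (Inner (act b o)) - I b).
  exists (e / 2 + 2 * M) => b; apply: le_trans (key b) _.
  rewrite lerD2l /ball_indic indicE; case: (_ \in _); rewrite ?mulr1// mulr0.
  by rewrite mulr_ge0.
have bF : bounded_function (fun b => F (Inner (act b o))) by exists M.
rewrite -meanB//; last first.
  have [L hL] := bI; exists (M + L) => b.
  rewrite -[I b](subKr (F (Inner (act b o)))).
  by apply: le_trans (ler_normB _ _) _; rewrite lerD.
apply: le_trans (norm_mean_le (hw n) bI) _.
have bB : bounded_function (ball_indic D) by exact: bounded_function_indic.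
apply: le_trans (mean_le (hw n) (bounded_function_norm bI)
  (bounded_function_affine _ _ bB) key) _.
rewrite (mean_affine (hw n) _ _ bB).
have := ler_wpM2l (mulr_ge0 (ler0n R 2) M0) (hN _ Nn); lra.
Qed.

(** For independent positions [a] and [b] of the walk at large times, [a b o] is
    close to [a o], since [b o] avoids the shadow of [a^-1 o]. *)
Lemma walk_decoupling (e : R) : 0 < e -> exists N, forall m k, (N <= m)%N -> (N <= k)%N ->
  mean (mun m) (fun a => mean (mun k) (fun b =>
    `|F (Inner (act (a * b)%g o)) - F (Inner (act a o))|)) <= e.
Proof.
move=> e0; have e40 : 0 < e / 4 by rewrite divr_gt0.
have [e' [e'0 He']] := small e40.
have [r [N1 hr]] := walk_avoids_shadow e'0.
have [r1 hr1] := compactification_uniform_continuous hyp hfin hgeo cF e40.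
pose D := r1 + r.
have [N2 hN] := escape D e'0; exists (maxn N1 N2) => m k.
rewrite !geq_max => /andP[N1m N2m] /andP[N1k N2k].
pose S a : set G := [set b | r <= gromov_product o (act b o) (act a^-1%g o)].
have key a b : `|F (Inner (act (a * b)%g o)) - F (Inner (act a o))|
    <= (e / 4 + 2 * M * ball_indic D a) + 2 * M * \1_(S a) b.
  have M20 : 0 <= 2 * M by rewrite mulr_ge0.
  have s0 : 0 <= 2 * M * \1_(S a) b by rewrite mulr_ge0// indicE.
  have FFB := FB (Inner (act (a * b)%g o)) (Inner (act a o)).
  rewrite /ball_indic indicE; have [_|/negP aD] := boolP (a \in _).
    rewrite mulr1; lra.
  move: s0; rewrite indicE; have [_|/negP bS] := boolP (b \in S a); first by rewrite !mulr1 mulr0; lra.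
  move=> _; rewrite !mulr0 !addr0; apply/ltW.
  apply: (hr1 _ _ (cst (act (a * b)%g o)) (cst (act a o))) => //.
  apply/near_at_cst; rewrite actionM gromov_product_act.
  move: aD bS; rewrite !inE /S /= => /negP; rewrite -ltNge => aD /negP; rewrite -ltNge.
  by rewrite /D in aD; lra.
have bS a : bounded_function (\1_(S a) : G -> R) by exact: bounded_function_indic.
have bD : bounded_function (ball_indic D) by exact: bounded_function_indic.
have inner a : mean (mun k) (fun b => `|F (Inner (act (a * b)%g o)) - F (Inner (act a o))|)
    <= (e / 4 + e / 4) + 2 * M * ball_indic D a.
  apply: le_trans (mean_le (hw k) _ (bounded_function_affine _ _ (bS a)) (key a)) _.
    by exists (2 * M) => b; rewrite normr_id.
  rewrite (mean_affine (hw k) _ _ (bS a)).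
  have := ler_wpM2l (mulr_ge0 (ler0n R 2) M0) (hr _ (act a^-1%g o) N1k).
  rewrite -/(S a); lra.
apply: le_trans (mean_le (hw m) _ (bounded_function_affine _ _ bD) inner) _.
  by exists (2 * M) => a; apply: mean_bound => // b; rewrite normr_id.
rewrite (mean_affine (hw m) _ _ bD).
have := ler_wpM2l (mulr_ge0 (ler0n R 2) M0) (hN _ N2m); lra.
Qed.

End limit.

End convergence.

(** * The law of the walk *)

Section countable_partition.
Context {d : measure_display} {T : measurableType d} {R : realType}.
Context (P : probability T R) {G : choiceType} (f : G -> nat).
Hypothesis finj : injective f.
Variable E : G -> set T.
Hypotheses (mE : forall g, measurable (E g))
  (tE : forall g h x, E g x -> E h x -> g = h).
Local Open Scope ereal_scope.

(** The family [E], indexed by the values of the enumeration [f]. *)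
Let fiber (k : nat) : set T := \bigcup_(g in [set g | f g = k]) E g.

Let fiberE g : fiber (f g) = E g.
Proof.
apply/seteqP; split=> [x [h /= /finj ->]//|x Ex].
by exists g.
Qed.

Let fiber0 k : ~ range f k -> fiber k = set0.
Proof.
move=> kf; apply/seteqP; split=> // x [g /= gk _]; apply: kf; by exists g.
Qed.

Let measurable_fiber k : measurable (fiber k).
Proof.
have [[g _ <-]|kf] := pselect (range f k); first by rewrite fiberE.
by rewrite fiber0.
Qed.

Let fiber_nneseries (a : set T -> \bar R) : a set0 = 0 -> (forall A, 0 <= a A) ->
  \sum_(k <oo) a (fiber k) = \esum_(g in [set: G]) a (E g).
Proof.
move=> a00 a0; rewrite nneseries_esumT//.
rewrite (esumID (range f))// setTI [X in _ + X]esum1 ?adde0; last first.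
  by move=> k [_ /= kf]; rewrite fiber0.
rewrite esum_image; first by apply: eq_esum => g _; rewrite fiberE.
by move=> g h _ _; exact: finj.
Qed.

Let fiber_trivIset : trivIset setT fiber.
Proof. by move=> i j _ _ [x [[g <- gx] [h <- hx]]]; rewrite (tE gx hx). Qed.

Let fiber_bigcup : \bigcup_k fiber k = \bigcup_g E g.
Proof.
apply/seteqP; split=> [x [k _ [g _ gx]]|x [g _ gx]]; first by exists g.
by exists (f g) => //; exists g.
Qed.

(** Countable additivity for families indexed by a countable type, as a sum
    over this type. *)
Lemma measure_countable_partition : P (\bigcup_g E g) = \esum_(g in [set: G]) P (E g).
Proof.
rewrite -fiber_bigcup measure_bigcup//.
rewrite -fiber_nneseries//.
by apply: eq_eseriesl => k; rewrite in_setT.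
Qed.

Lemma integral_countable_partition (h : T -> \bar R) : \bigcup_g E g = setT ->
  measurable_fun setT h -> (forall x, 0 <= h x) ->
  \int[P]_x h x = \esum_(g in [set: G]) \int[P]_(x in E g) h x.
Proof.
move=> ET mh h0; rewrite -(@fiber_nneseries (fun A => \int[P]_(x in A) h x)).
- rewrite -[in LHS]ET -fiber_bigcup ge0_integral_bigcup//.
  by rewrite fiber_bigcup ET.
- by rewrite integral_set0.
- by move=> A; exact: integral_ge0.
Qed.

End countable_partition.

Section law.
Context {R : realType} {G : groupType} (mu : G -> R).
Hypothesis hmu : probability_weights mu.
Hypothesis cG : countable [set: G].
Context {d : measure_display} {Omega : measurableType d} (P : probability Omega R).
Variable H : nat -> Omega -> G.
Hypothesis hH : iid_of_law mu P H.
Notation mun := (convolution_power mu).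
Local Open Scope ereal_scope.

Lemma walkS n w : walk H n.+1 w = (walk H n w * H n w)%g.
Proof. by rewrite /walk big_ord_recr. Qed.

Lemma walk_measurable n (A : set G) : measurable (walk H n @^-1` A).
Proof.
have [mH _ _] := hH; elim: n A => [|n ih] A.
  have [A1|A1] := pselect (A 1%g).
    rewrite (_ : _ @^-1` A = setT)//; apply/seteqP; split=> // w _.
    by rewrite /= /walk big_ord0.
  rewrite (_ : _ @^-1` A = set0)//; apply/seteqP; split=> // w /=.
  by rewrite /walk big_ord0.
rewrite (_ : _ @^-1` A = \bigcup_g
    (walk H n @^-1` [set g] `&` H n @^-1` [set s | A (g * s)%g])); last first.
  apply/seteqP; split=> w /=; rewrite walkS.
    by move=> Aw; exists (walk H n w).
  by move=> [g _ [/= -> ]].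
apply: countable_bigcupT_measurable => // g; exact: measurableI.
Qed.

Lemma esum_convolution_term (p q : G -> R) g :
  probability_weights p -> probability_weights q ->
  \esum_(h in [set: G]) (p h * q (h^-1 * g)%g)%:E = (convolution p q g)%:E.
Proof.
move=> hp hq; rewrite convolutionE// -ge0_esum_mean//.
- by apply: eq_esum => h _; rewrite mulrC.
- by exists 1%R => h; rewrite ger0_norm ?hq.1// weight_le1.
- by move=> h; exact: hq.1.
Qed.

(** The walk at time [n] is independent from the later increments. *)
Lemma walk_law_indep n g (J : {fset nat}) (A : nat -> set G) :
  (forall i, i \in J -> (n <= i)%N) ->
  P (walk H n @^-1` [set g] `&` \bigcap_(i in [set` J]) H i @^-1` A i)
  = (mun n g)%:E * \prod_(i <- J) P (H i @^-1` A i).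
Proof.
have [mH lawH indH] := hH; have /countable_injP[f finj] := cG.
have finj' : injective f by move=> x y; apply: finj; rewrite inE.
have hw := convolution_power_weights hmu.
elim: n g J A => [|n ih] g J A hJ.
  rewrite /=; have [->|g1] := eqVneq g 1%g.
    rewrite mul1e -indH [X in X `&` _](_ : _ = setT) ?setTI//.
    by apply/seteqP; split=> // w _ /=; rewrite /walk big_ord0.
  rewrite mul0e [X in X `&` _](_ : _ = set0) ?set0I ?measure0//.
  apply/seteqP; split=> // w /=; rewrite /walk big_ord0 => g1'.
  by rewrite -g1' eqxx in g1.
set B := \bigcap_(i in _) _.
have mB : measurable B by apply: fin_bigcap_measurable => // i _.
pose E h := walk H n @^-1` [set h] `&` (H n @^-1` [set h^-1 * g]%g `&` B).
have -> : walk H n.+1 @^-1` [set g] `&` B = \bigcup_h E h.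
  apply/seteqP; split=> [w [/= + Bw]|w [h _ [/= hw' [/= Hw Bw]]]].
    rewrite walkS => wg; exists (walk H n w) => //; split=> //; split=> //=.
    by rewrite -wg mulKg.
  by split=> //=; rewrite walkS hw' Hw mulVKg.
rewrite (measure_countable_partition P finj'); last 2 first.
- move=> h; apply: measurableI; first exact: walk_measurable.
  exact: measurableI.
- by move=> h k w [/= hw1 _] [/= hw2 _]; rewrite -hw1 -hw2.
have nJ : n \notin J by apply/negP => /hJ; rewrite ltnn.
pose A' h i := if i == n then [set h^-1 * g]%g else A i.
have PE h : P (E h) = (mun n h * mu (h^-1 * g)%g)%:E * \prod_(i <- J) P (H i @^-1` A i).
  have -> : E h = walk H n @^-1` [set h] `&`
      \bigcap_(i in [set` (n |` J)%fset]) H i @^-1` A' h i.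
    congr (_ `&` _); apply/seteqP; split=> w /=.
      move=> [Hw Bw] i /=; rewrite in_fset1U => /orP[/eqP ->|iJ]; rewrite /A' /=.
        by rewrite eqxx.
      by rewrite ifN; [exact: Bw|apply: contraNneq nJ => <-].
    move=> hw'; split; first by have := hw' n; rewrite /A' /= eqxx; apply; rewrite fset1U1.
    move=> i /= iJ; have := hw' i; rewrite /A' /= ifN.
      by apply; rewrite in_fset1U iJ orbT.
    by apply: contraNneq nJ => <-.
  rewrite ih; last by move=> i; rewrite in_fset1U => /orP[/eqP->//|/hJ/ltnW].
  rewrite big_fsetU1//= /A' eqxx lawH EFinM muleA; congr (_ * _).
  rewrite big_seq [RHS]big_seq; apply: eq_bigr => i iJ.
  by rewrite ifN//; apply: contraNneq nJ => <-.
have c0 : 0 <= \prod_(i <- J) P (H i @^-1` A i) by apply: prode_ge0 => i _.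
have cfin : \prod_(i <- J) P (H i @^-1` A i) \is a fin_num.
  by apply: prode_fin_num => i _; exact: fin_num_measure.
under eq_esum do rewrite PE muleC.
rewrite -(fineK cfin) ge0_esumZl ?fine_ge0//; last first.
  by move=> h; rewrite lee_fin mulr_ge0 ?(hw n).1 ?hmu.1.
by rewrite esum_convolution_term// muleC.
Qed.

Lemma walk_law n g : P (walk H n @^-1` [set g]) = (mun n g)%:E.
Proof.
have := @walk_law_indep n g fset0 (fun=> setT).
by rewrite big_seq_fset0 mule1 set_fset0 bigcap_set0 setIT; apply.
Qed.

Lemma ge0_integral_walk n (Psi : G -> \bar R) : (forall g, 0 <= Psi g) ->
  \int[P]_w Psi (walk H n w) = \esum_(g in [set: G]) (Psi g * (mun n g)%:E).
Proof.
move=> Psi0; have /countable_injP[f finj] := cG.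
have finj' : injective f by move=> x y; apply: finj; rewrite inE.
rewrite (integral_countable_partition P finj' (E := fun g => walk H n @^-1` [set g])).
- apply: eq_esum => g _; rewrite -walk_law.
  rewrite (eq_integral (cst (Psi g))); last by move=> w; rewrite inE /= => ->.
  by rewrite integral_cst//; exact: walk_measurable.
- by move=> g; exact: walk_measurable.
- by move=> g h w /= -> ->.
- by apply/seteqP; split=> // w _; exists (walk H n w).
- move=> _ B mB; rewrite setTI; exact: (walk_measurable n (Psi @^-1` B)).
- by [].
Qed.

(** No summability is needed: both sides are the difference of the sums of the
    positive and of the negative parts. *)
Lemma expectation_walk n (Phi : G -> R) :
  'E_P[fun w => Phi (walk H n w)] = sum_over (fun g => (Phi g * mun n g)%R).
Proof.
have hw := convolution_power_weights hmu.
rewrite unlock /sum_over integralE; congr (_ - _).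
  under eq_integral do rewrite funeposE.
  rewrite (@ge0_integral_walk n (fun g => maxe (Phi g)%:E 0)); last first.
    by move=> g; rewrite le_max lexx orbT.
  apply: eq_esum => g _; rewrite funeposE /= EFinM.
  by rewrite maxe_pMl ?mul0e// lee_fin (hw n).1.
under eq_integral do rewrite funenegE.
rewrite (@ge0_integral_walk n (fun g => maxe (- (Phi g)%:E) 0)); last first.
  by move=> g; rewrite le_max lexx orbT.
apply: eq_esum => g _; rewrite funenegE.
have -> : (EFin \o (fun g => Phi g * mun n g)%R) g = (Phi g)%:E * (mun n g)%:E by [].
rewrite -mulNe.
by rewrite maxe_pMl ?mul0e// lee_fin (hw n).1.
Qed.

End law.

(** * Asymptotic independence of the two ends of the walk *)

Section joint.
Context {R : realType} {G : groupType} {X : metricType R}.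
Variables (act : isometric_action G X) (o : X) (xi0 : boundary o).
Context (mu : G -> R) (nu : probability (borel_boundary xi0) R).
Hypotheses (hhyp : hyperbolic X) (hfin : finite_balls X) (hgeo : roughly_geodesic X)
  (hproper : proper_action act).
Hypotheses (hmu : probability_weights mu) (hsym : symmetric_weights mu).
Hypothesis hne : nonelementary act o (generated_semigroup (support_weights mu)).
Hypothesis hnu : stationary act mu nu.
Notation mun := (convolution_power mu).

Let orbit (F : compactification o -> R) (g : G) : R := F (Inner (act g o)).

(** The positions of [o] under the walk and under its inverse are asymptotically
    independent, each of them distributed according to [nu] in the limit. *)
Lemma walk_joint_cvg (F1 F2 : compactification o -> R) (M : R) :
  continuous F1 -> continuous F2 ->
  (forall a, `|F1 a| <= M) -> (forall a, `|F2 a| <= M) ->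
  mean (mun n) (fun g => F1 (Inner (act g o)) * F2 (Inner (act g^-1%g o))) @[n --> \oo]
  --> \int[nu]_xi F1 (Bdry xi) * \int[nu]_xi F2 (Bdry xi).
Proof.
move=> cF1 cF2 FM1 FM2; have [delta _ hyp] := hhyp.
have hw := convolution_power_weights hmu.
have M0 : 0 <= M by apply: le_trans (normr_ge0 _) (FM1 (Inner o)).
have bF (F : compactification o -> R) : (forall a, `|F a| <= M) -> bounded_function (orbit F).
  by move=> FM; exists M => g; exact: FM.
apply/cvgrPdist_le => e e0; pose e' := e / (4 * (M + 1)).
have e'0 : 0 < e' by rewrite divr_gt0//; lra.
have eE : e = 4 * (M * e') + 4 * e'.
  rewrite -mulrDr -{2}[e']mul1r -mulrDl mulrA /e' mulrC divfK// gt_eqF//; lra.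
have [N1 h1] := walk_cvg_stationary hyp hfin hgeo hproper hmu hsym hne hnu cF1 FM1 e'0.
have [N2 h2] := walk_cvg_stationary hyp hfin hgeo hproper hmu hsym hne hnu cF2 FM2 e'0.
have [N3 h3] := walk_decoupling hyp hfin hgeo hproper hmu hsym hne hnu cF1 FM1 e'0.
have [N4 h4] := walk_decoupling hyp hfin hgeo hproper hmu hsym hne hnu cF2 FM2 e'0.
pose m := maxn (maxn N1 N2) (maxn N3 N4).
exists (m + m)%N => // n /= mmn.
pose k := (n - m)%N.
have mk : (m <= k)%N by rewrite /k leq_subRL// (leq_trans (leq_addr _ _) mmn).
have -> : n = (m + k)%N by rewrite subnKC// (leq_trans (leq_addr _ _) mmn).
have N1m : (N1 <= m)%N := leq_trans (leq_maxl N1 N2) (leq_maxl _ _).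
have N2m : (N2 <= m)%N := leq_trans (leq_maxr N1 N2) (leq_maxl _ _).
have N3m : (N3 <= m)%N := leq_trans (leq_maxl N3 N4) (leq_maxr _ _).
have N4m : (N4 <= m)%N := leq_trans (leq_maxr N3 N4) (leq_maxr _ _).
pose A1 := mean (mun m) (orbit F1); pose A2 := mean (mun k) (orbit F2).
pose I1 := \int[nu]_xi F1 (Bdry xi); pose I2 := \int[nu]_xi F2 (Bdry xi).
have d1 : `|A1 - I1| <= e' by exact: h1.
have d2 : `|A2 - I2| <= e' by apply: h2; exact: leq_trans mk.
have bA1 : `|A1| <= M by apply: mean_bound => // a; exact: FM1.
have bI2 : `|I2| <= M.
  have mf2 : measurable_fun setT ((fun xi => F2 (Bdry xi)) : borel_boundary xi0 -> R).
    exact: continuous_boundary_measurable.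
  have := @Rintegral_near_cst _ _ _ nu _ 0 M M set0 mf2 measurable0 M0.
  rewrite subr0 measure0 mulr0 addr0; apply => xi; by rewrite subr0.
pose J (a b : G) := F1 (Inner (act (a * b)%g o)) * F2 (Inner (act (a * b)^-1%g o)).
have JM a b : `|J a b| <= M * M by rewrite normrM ler_pM.
rewrite distrC mean_powerD//; last by exists (M * M) => g; rewrite normrM ler_pM.
rewrite -/I1 -/I2.
pose J' (a b : G) := orbit F1 a * orbit F2 b^-1%g.
have J'M a b : `|J' a b| <= M * M by rewrite normrM ler_pM// ?FM1 ?FM2.
have mJ' : mean (mun m) (fun a => mean (mun k) (J' a)) = A1 * A2.
  transitivity (mean (mun m) (fun a => A2 * orbit F1 a)); last first.
    by rewrite (meanZ (hw m) _ (bF _ FM1)) mulrC.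
  congr mean; apply/funext => a; rewrite /J' (meanZ (hw k) _
    (bounded_function_comp (fun b => b^-1)%g (bF _ FM2))).
  by rewrite (mean_powerV hmu k hsym (bF _ FM2)) mulrC.
pose T1 a b := `|F1 (Inner (act (a * b)%g o)) - F1 (Inner (act a o))|.
pose T2 a b := `|F2 (Inner (act (a * b)%g o)) - F2 (Inner (act a o))|.
have T1M a b : `|T1 a b| <= M + M.
  by rewrite normr_id; apply: le_trans (ler_normB _ _) _; rewrite lerD.
have T2M a b : `|T2 a b| <= M + M.
  by rewrite normr_id; apply: le_trans (ler_normB _ _) _; rewrite lerD.
have t1 : mean (mun m) (fun a => mean (mun k) (T1 a)) <= e'.
  by apply: h3 => //; exact: leq_trans mk.
(* reverse time: exchange the two halves and invert both of them *)
have t2 : mean (mun m) (fun a => mean (mun k) (fun b => T2 b^-1 a^-1)%g) <= e'.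
  rewrite (mean_swap (M := M + M))// -(mean_powerV hmu k hsym); last first.
    exact: (bounded_function_mean (M := M + M)).
  under eq_fun => b do under eq_fun => a do rewrite invgK.
  apply: le_trans (h4 k m _ N4m); last exact: leq_trans mk.
  rewrite le_eqVlt; apply/orP; left; apply/eqP; congr mean; apply/funext => b.
  rewrite (mean_powerV (F := T2 b) hmu m hsym)//.
  by exists (M + M).
have JJ' a b : `|J a b - J' a b| <= M * T1 a b + M * T2 b^-1%g a^-1%g.
  have -> : J a b - J' a b =
      (F1 (Inner (act (a * b)%g o)) - F1 (Inner (act a o))) * F2 (Inner (act (a * b)^-1%g o))
      + F1 (Inner (act a o)) * (F2 (Inner (act (b^-1 * a^-1)%g o)) - F2 (Inner (act b^-1%g o))).
    by rewrite /J /J' /orbit invgM mulrBl mulrBr addrA subrK.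
  apply: le_trans (ler_normD _ _) _; rewrite !normrM lerD//.
    by rewrite mulrC ler_wpM2r.
  by rewrite ler_wpM2r.
have main : `|mean (mun m) (fun a => mean (mun k) (J a)) - A1 * A2| <= M * e' + M * e'.
  pose T2' a b := T2 b^-1%g a^-1%g.
  have bT1 a : bounded_function (T1 a) by exists (M + M).
  have bT2 a : bounded_function (T2' a) by exists (M + M) => b; exact: T2M.
  have bJ a : bounded_function (J a) by exists (M * M).
  have bJ' a : bounded_function (J' a) by exists (M * M).
  have bM (K : G -> R) : bounded_function K -> bounded_function (fun b => M * K b).
    move=> bK; apply: (@bounded_function_mul _ _ (cst M)) => //.
    exact: bounded_function_cst.
  have bmean (K : G -> G -> R) L : (forall a b, `|K a b| <= L) ->
      bounded_function (fun a => mean (mun k) (K a)).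
    by move=> hK; exact: (bounded_function_mean (M := L)).
  rewrite -mJ' -(meanB (hw m) (bmean _ _ JM) (bmean _ _ J'M)).
  have mT1 := bmean _ _ T1M.
  have mT2 := bmean T2' _ (fun a b => T2M _ _).
  have bB := bounded_function_add (bM _ mT1) (bM _ mT2).
  have inner a : `|mean (mun k) (J a) - mean (mun k) (J' a)|
      <= M * mean (mun k) (T1 a) + M * mean (mun k) (T2' a).
    rewrite -(meanB (hw k) (bJ a) (bJ' a)) -(meanZ (hw k) M (bT1 a)).
    rewrite -(meanZ (hw k) M (bT2 a)) -(meanD (hw k) (bM _ (bT1 a)) (bM _ (bT2 a))).
    have bD : bounded_function (fun b => J a b - J' a b).
      exists (M * M + M * M) => b.
      by apply: le_trans (ler_normB _ _) _; rewrite lerD.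
    apply: le_trans (norm_mean_le (hw k) bD) _.
    apply: mean_le => //; first exact: bounded_function_norm.
    by apply: bounded_function_add; exact: bM.
  have bL : bounded_function (fun a => mean (mun k) (J a) - mean (mun k) (J' a)).
    have [L hL] := bB; exists L => a; apply: le_trans (inner a) _.
    exact: le_trans (ler_norm _) (hL a).
  apply: le_trans (norm_mean_le (hw m) bL) _.
  apply: le_trans (mean_le (hw m) (bounded_function_norm bL) bB inner) _.
  rewrite (meanD (hw m) (bM _ mT1) (bM _ mT2)) (meanZ (hw m) M mT1) (meanZ (hw m) M mT2).
  by rewrite lerD// ler_wpM2l.
have -> : mean (mun m) (fun a => mean (mun k) (J a)) - I1 * I2 =
  (mean (mun m) (fun a => mean (mun k) (J a)) - A1 * A2) + (A1 * (A2 - I2) + (A1 - I1) * I2).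
  by rewrite mulrBr mulrBl !addrA !subrK.
apply: le_trans (ler_normD _ _) _; rewrite eE.
have : `|A1 * (A2 - I2) + (A1 - I1) * I2| <= M * e' + M * e'.
  apply: le_trans (ler_normD _ _) _; rewrite !normrM lerD//.
    exact: ler_pM.
  by rewrite mulrC ler_pM.
lra.
Qed.

End joint.

Lemma proper_action_countable (R : realType) (G : groupType) (X : metricType R)
    (act : isometric_action G X) (o : X) :
  finite_balls X -> proper_action act -> countable [set: G].
Proof.
move=> hfin hproper.
rewrite (_ : [set: G] = \bigcup_n [set g | mdist (act g o) o <= n%:R]).
  apply: bigcup_countable => // n _; apply: finite_set_countable.
  exact: finite_orbit_ball.
apply/seteqP; split=> // g _; have [n hn] := ex_natr_ge (mdist (act g o) o).
by exists n => //; exact: hn.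
Qed.

Theorem theorem1 (R : realType) (X : metricType R) (o : X)
    (G : groupType) (act : isometric_action G X) (mu : G -> R)
    (xi0 : boundary o) (nu : probability (borel_boundary xi0) R)
    (f1 f2 : compactification o -> boundary o)
    (phi1 phi2 : boundary o -> R)
    (hfin : finite_balls X) (hhyp : hyperbolic X)
    (hgeo : roughly_geodesic X)
    (hproper : proper_action act)
    (hG : nonelementary act o [set: G])
    (hmu : probability_weights mu)
    (hsym : symmetric_weights mu)
    (hne : nonelementary act o (generated_semigroup (support_weights mu)))
    (hmoment : first_moment act o mu)
    (hnu : stationary act mu nu)
    (hf1 : boundary_retraction f1) (hf2 : boundary_retraction f2)
    (hphi1 : continuous phi1) (hphi2 : continuous phi2) :
  ((forall (d : measure_display) (Omega : measurableType d)
      (P : probability Omega R) (H : nat -> Omega -> G),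
    iid_of_law mu P H -> forall n : nat,
      'E_P[(fun w => phi1 (f1 (Inner (act (walk H n w) o)))
                     * phi2 (f2 (Inner (act (walk H n w)^-1%g o))))%R]
      = sum_over (fun g => phi1 (f1 (Inner (act g o)))
                            * phi2 (f2 (Inner (act g^-1%g o)))
                            * convolution_power mu n g)%R)
  /\ (sum_over (fun g => phi1 (f1 (Inner (act g o)))
                         * phi2 (f2 (Inner (act g^-1%g o)))
                         * convolution_power mu n g)%R @[n --> \oo]
      --> ((\int[nu]_xi (phi1 xi)%:E) * (\int[nu]_xi (phi2 xi)%:E))))%E.
Proof.
have [delta _ hyp] := hhyp.
split=> [d Omega P H hH n|].
  rewrite (expectation_walk hmu (proper_action_countable o hfin hproper) hH n
    (fun g => phi1 (f1 (Inner (act g o))) * phi2 (f2 (Inner (act g^-1%g o))))%R).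
  by [].
have [cf1 fid1] := hf1; have [cf2 fid2] := hf2.
have [M1 hM1] := boundary_continuous_bounded hyp hfin hgeo hf1 hphi1.
have [M2 hM2] := boundary_continuous_bounded hyp hfin hgeo hf2 hphi2.
pose M := Num.max M1 M2.
have FM1 a : `|(phi1 \o f1) a| <= M by rewrite le_max hM1.
have FM2 a : `|(phi2 \o f2) a| <= M by rewrite le_max hM2 orbT.
have cF1 : continuous (phi1 \o f1).
  by move=> a; apply: continuous_comp; [exact: cf1|exact: hphi1].
have cF2 : continuous (phi2 \o f2).
  by move=> a; apply: continuous_comp; [exact: cf2|exact: hphi2].
have intE (F : compactification o -> R) (phi : boundary o -> R) : continuous F ->
    (forall a, `|F a| <= M) -> (forall xi, F (Bdry xi) = phi xi) ->
    (\int[nu]_xi (phi xi)%:E = (\int[nu]_xi F (Bdry xi))%:E)%E.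
  move=> cF FM Fphi; rewrite /Rintegral fineK; last first.
    apply: integrable_fin_num => //.
    apply: (@bounded_measurable_integrable _ _ _ nu _ M) => //.
    exact: continuous_boundary_measurable.
  by apply: eq_integral => xi _; rewrite Fphi.
rewrite (intE (phi1 \o f1))//; last by move=> xi /=; rewrite fid1.
rewrite (intE (phi2 \o f2))//; last by move=> xi /=; rewrite fid2.
rewrite -EFinM.
have cvg := walk_joint_cvg hhyp hfin hgeo hproper hmu hsym hne hnu cF1 cF2 FM1 FM2.
have bF : bounded_function (fun g => phi1 (f1 (Inner (act g o)))
    * phi2 (f2 (Inner (act g^-1%g o))))%R.
  by exists (M * M)%R => g; rewrite normrM ler_pM// ?FM1 ?FM2.
have meanE n := sum_over_mean (convolution_power_weights hmu n) bF.
apply: cvg_EFin; first by apply: nearW => n; rewrite meanE.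
by under [X in X @ _ --> _]eq_fun do rewrite /= meanE.
Qed.
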